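(* There are affine varieties $X$ and $Y$ over $k$ such that (a) $X$ is not flattenable; (b) $Y$ and $X\times Y$ are flattenable.
   Context: $k$ is an algebraically closed field of characteristic zero; varieties are over $k$ (in the sense of Serre), with the Zariski topology. An irreducible variety is called flattenable if it is isomorphic to an open subset of an affine space $\mathbf A^n$. *)

(* Defs.v *)
From mathcomp Require Import all_boot all_order all_algebra.
From mathcomp Require Import mpoly.

Set Implicit Arguments.
Unset Strict Implicit.
Unset Printing Implicit Defensive.

Import GRing.Theory.
Local Open Scope ring_scope.

(* The points of the affine space A^n over k are the row vectors 'rV[k]_n, and
   subsets of A^n are Prop-valued predicates on them. *)
Definition subset_of_space (k : fieldType) (n : nat) : Type := 'rV[k]_n -> Prop.

Definition ev (k : fieldType) (n : nat) (p : {mpoly k[n]}) (x : 'rV[k]_n) : k :=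
  p.@[fun i => x ord0 i].

Definition zariski_closed (k : fieldType) (n : nat) (Z : subset_of_space k n) :
    Prop :=
  exists S : {mpoly k[n]} -> Prop,
    forall x, Z x <-> (forall p, S p -> ev p x = 0).

Definition zariski_open (k : fieldType) (n : nat) (U : subset_of_space k n) :
    Prop :=
  zariski_closed (fun x => ~ U x).

(* Irreducibility in the subspace topology; the empty set is not irreducible. *)
Definition irreducible_set (k : fieldType) (n : nat) (V : subset_of_space k n) :
    Prop :=
  (exists x, V x) /\
  forall Z1 Z2 : subset_of_space k n,
    zariski_closed Z1 -> zariski_closed Z2 ->
    (forall x, V x -> Z1 x \/ Z2 x) ->
    (forall x, V x -> Z1 x) \/ (forall x, V x -> Z2 x).

(* The germ at a of the k-valued function f on V belongs to the local ring
   O_{a,V}: f is a quotient of polynomials on a neighbourhood of a in V. Here f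
   is total on A^n, and only its values on V matter. *)
Definition regular_at (k : fieldType) (n : nat) (V : subset_of_space k n)
    (f : 'rV[k]_n -> k) (a : 'rV[k]_n) : Prop :=
  exists (U : subset_of_space k n) (p q : {mpoly k[n]}),
    [/\ zariski_open U, U a &
        forall x, V x -> U x -> ev q x != 0 /\ f x = ev p x / ev q x].

Definition continuous_on (k : fieldType) (n m : nat) (V : subset_of_space k n)
    (phi : 'rV[k]_n -> 'rV[k]_m) : Prop :=
  forall U : subset_of_space k m, zariski_open U ->
    exists2 U' : subset_of_space k n, zariski_open U' &
      forall x, V x -> (U (phi x) <-> U' x).

(* Morphisms in the sense of Serre: continuous maps pulling germs of regular
   functions back to germs of regular functions. The map phi is total on A^n, and
   only its values on V matter. *)
Definition regular_map (k : fieldType) (n m : nat) (V : subset_of_space k n)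
    (W : subset_of_space k m) (phi : 'rV[k]_n -> 'rV[k]_m) : Prop :=
  [/\ forall x, V x -> W (phi x),
      continuous_on V phi &
      forall a f, V a -> regular_at W f (phi a) -> regular_at V (f \o phi) a].

Definition isomorphic (k : fieldType) (n m : nat) (V : subset_of_space k n)
    (W : subset_of_space k m) : Prop :=
  exists (phi : 'rV[k]_n -> 'rV[k]_m) (psi : 'rV[k]_m -> 'rV[k]_n),
    [/\ regular_map V W phi, regular_map W V psi,
        forall x, V x -> psi (phi x) = x &
        forall y, W y -> phi (psi y) = y].

(* Being flattenable is only meaningful for irreducible V; reducible (or empty)
   sets are never flattenable here, so a statement of non-flattenability has to
   be accompanied by irreducibility. *)
Definition flattenable (k : fieldType) (n : nat) (V : subset_of_space k n) :
    Prop :=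
  irreducible_set V /\
  exists (d : nat) (U : subset_of_space k d), zariski_open U /\ isomorphic V U.

Definition product_set (k : fieldType) (n m : nat) (X : subset_of_space k n)
    (Y : subset_of_space k m) : subset_of_space k (n + m) :=
  fun z => X (lsubmx z) /\ Y (rsubmx z).

(* Main.v *)
Require Import Defs.
From mathcomp Require Import all_boot all_order all_algebra.
From HB Require Import structures.
From mathcomp Require Import ssrcomplements mpoly ring.
From Stdlib Require Import Classical.

(** Take X = SL_2 in A^4 and Y = {xy = 1} in A^2. Scaling the first column of a
    matrix of determinant 1 identifies X x Y with GL_2, a basic open subset of A^4,
    and Y is A^1 minus a point.

    Let U be open in A^d and isomorphic to SL_2. As k[x_1, ..., x_d] is factorial, each
    coordinate of the isomorphism psi : U -> SL_2 is a reduced fraction whose denominator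
    does not vanish on U; since SL_2 is the image of A^4 under a product of elementary
    matrices, a nonvanishing regular function on vt is constant, and psi is polynomial.
    The inverse phi is polynomial too, so t |-> psi (t * phi g) is a polynomial
    contraction of SL_2. But the invariant volume form of SL_2 is not exact in
    characteristic zero: the integral over SU(2), which has an algebraic expression on
    monomials, vanishes on derivatives along the invariant vector fields and is 1 at 1. *)

Set Implicit Arguments.
Unset Strict Implicit.
Unset Printing Implicit Defensive.

Import GRing.Theory.
Local Open Scope ring_scope.

(** * Factoriality of polynomial rings *)

(** The segment from 0 to [phi g] need not stay in U, so the contraction makes sense only once psi
    is known to be polynomial. It then extends to all of A^d, and det psi = 1, true on the nonempty
    open U, holds identically, so the extension still lands in SL_2. This is why nowhere vanishing
    functions must be controlled first: a denominator of psi, composed with phi, has no zero on SL_2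
    and hence is constant.

    No topology is available over k, so the obstruction is a linear functional prescribed on
    monomials: it kills the ideal of SL_2 and all derivatives along e, f, h, and it keeps t as a
    parameter. The integral of the pulled-back volume is then a polynomial in t with zero
    derivative, hence constant in characteristic zero. But it is 0 at t = 0, where the map is
    constant, and 1 at t = 1, where the map is the identity. *)

Section PrimeFactorization.
Variable D : idomainType.
Implicit Types a b c p q : D.

Definition divides a b := exists c, b = a * c.

Definition prime_elt p :=
  [/\ p != 0, p \isn't a GRing.unit &
      forall a b, divides p (a * b) -> divides p a \/ divides p b].

(** The index counts primes with multiplicity; it is the induction measure when primes are stripped
    from a leading coefficient. *)
Inductive prime_product : nat -> D -> Prop :=
| PrimeProductUnit u : u \is a GRing.unit -> prime_product 0 u
| PrimeProductCons m p a :
    prime_elt p -> prime_product m a -> prime_product m.+1 (p * a).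

(** Since the factors are prime and not merely irreducible, this is unique factorization: uniqueness
    is automatic. *)
Definition prime_factorizable := forall a, a != 0 -> exists m, prime_product m a.

Lemma divides_mulr a b c : divides a b -> divides a (b * c).
Proof. by case=> d ->; exists (d * c); rewrite mulrA. Qed.

Lemma dividesD a b c : divides a b -> divides a c -> divides a (b + c).
Proof. by move=> [d ->] [e ->]; exists (d + e); rewrite mulrDr. Qed.

Lemma prime_notdvd_unit p u : prime_elt p -> u \is a GRing.unit -> ~ divides p u.
Proof. by case=> _ /negP pU _ uU [c e]; apply: pU; move: uU; rewrite e unitrM => /andP[]. Qed.

Lemma prime_product_unit m a u :
  u \is a GRing.unit -> prime_product m a -> prime_product m (u * a).
Proof.
move=> uU; elim=> [v vU|l p b pp _ IH].
  by apply: PrimeProductUnit; rewrite unitrM uU.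
by rewrite mulrCA; apply: PrimeProductCons.
Qed.

Lemma prime_productM m n a b :
  prime_product m a -> prime_product n b -> prime_product (m + n) (a * b).
Proof.
move=> + hb; elim=> [v vU|l p c pp _ IH]; first exact: prime_product_unit.
by rewrite -mulrA; apply: PrimeProductCons.
Qed.

(** Compare [p] with the first prime [r]: either they are associated and [r] is removed, or [p]
    divides the remaining factors. *)
Lemma prime_product_cancel m p b :
  prime_elt p -> prime_product m (p * b) -> exists2 l, (l < m)%N & prime_product l b.
Proof.
move=> pp; move e: (p * b) => a ha; elim: ha b e => {m a} [u uU b e|m r a pr ha IH b e].
  by case: (prime_notdvd_unit pp uU); exists b.
have [p0 pU _] := pp; have [r0 rU rP] := pr.
have [[v ev]|[a' ea]] : divides p r \/ divides p a.
- by case: pp => _ _; apply; exists b.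
- have : divides r (p * v) by rewrite -ev; exists 1; rewrite mulr1.
  case/rP => [[w ew]|[w ew]].
  + have eq1 : w * v = 1.
      by apply: (mulfI r0); rewrite mulrA -ew -ev mulr1.
    have vU : v \is a GRing.unit by apply/unitrP; exists w; split; rewrite // mulrC.
    exists m => //; have -> : b = v * a by apply: (mulfI p0); rewrite e ev mulrA.
    exact: prime_product_unit.
  + case/negP: pU; apply/unitrP; exists w; suff e1 : p * w = 1 by rewrite mulrC.
    by apply: (mulfI r0); rewrite mulr1 mulrCA -ew -ev.
- case: (IH a'); first by rewrite ea.
  move=> l lm hl; exists l.+1 => //.
  have -> : b = r * a' by apply: (mulfI p0); rewrite e ea mulrCA.
  exact: PrimeProductCons.
Qed.

(* Strip the primes of [q] one by one: a prime either divides [p] as well, or it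
   divides every denominator [q']. *)
Lemma lowest_terms : prime_factorizable -> forall p q, q != 0 ->
  exists p0 q0, [/\ q0 != 0, p * q0 = p0 * q &
    forall p' q', p * q' = p' * q -> divides q0 q'].
Proof.
move=> fD p q /[dup] q0 /fD[m hq]; elim: hq p q0 => {m q} [u uU|m r q pr hq IH] p.
  move=> _; exists (p * u^-1), 1; split; rewrite ?oner_neq0 //.
    by rewrite mulr1 -mulrA mulVr ?mulr1.
  by move=> p' q' _; exists q'; rewrite mul1r.
rewrite mulf_eq0 negb_or => /andP[r0 q0].
have [[p1 ep]|ndv] := classic (divides r p).
  have [p0 [q1 [q10 e h]]] := IH p1 q0.
  exists p0, q1; split=> //; first by rewrite ep -mulrA e [RHS]mulrCA.
  by move=> p' q'; rewrite ep -mulrA [RHS]mulrCA => /(mulfI r0)/h.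
have [p0 [q1 [q10 e h]]] := IH p q0.
exists p0, (r * q1); split; first by rewrite mulf_neq0.
  by rewrite mulrCA e [RHS]mulrCA.
move=> p' q' e'.
have [] : divides r p \/ divides r q'.
- by case: pr => _ _; apply; rewrite e' mulrCA; exists (p' * q).
- by [].
case=> q2 eq2; have := e'; rewrite eq2 mulrCA [RHS]mulrCA => /(mulfI r0)/h[c ->].
by exists c; rewrite mulrA.
Qed.

End PrimeFactorization.

Lemma field_prime_factorizable (F : fieldType) : prime_factorizable F.
Proof. by move=> a a0; exists 0; apply: PrimeProductUnit; rewrite unitfE. Qed.

Section Transfer.
Variables (D E : idomainType) (f : {rmorphism D -> E}) (g : {rmorphism E -> D}).
Hypotheses (fK : cancel f g) (gK : cancel g f).

Lemma prime_elt_iso p : prime_elt p -> prime_elt (g p).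
Proof.
case=> p0 pU pP; split.
- by apply: contra p0 => /eqP e; rewrite -[p]gK e rmorph0.
- by apply: contra pU => /(rmorph_unit f); rewrite gK.
move=> a b [c e]; case: (pP (f a) (f b)).
- by exists (f c); rewrite -rmorphM e rmorphM gK.
- by case=> d ed; left; exists (g d); rewrite -rmorphM -ed fK.
- by case=> d ed; right; exists (g d); rewrite -rmorphM -ed fK.
Qed.

Lemma prime_factorizable_iso : prime_factorizable E -> prime_factorizable D.
Proof.
move=> fE a a0; have [|m h] := fE (f a).
  by apply: contra a0 => /eqP e; rewrite -[a]fK e rmorph0.
exists m; rewrite -[a]fK; elim: h => {m} [u uU|m p b pp _ IH].
  by apply: PrimeProductUnit; apply: rmorph_unit.
by rewrite rmorphM; apply: PrimeProductCons => //; apply: prime_elt_iso.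
Qed.
End Transfer.

(** * Gauss's lemma: factoriality passes from a domain to its polynomial ring *)

Section Gauss.
Variable D : idomainType.
Implicit Types (c : D) (a b p q : {poly D}).

Lemma divides_polyC_coef c p : divides c%:P p -> divides c p`_0.
Proof. by case=> q ->; exists q`_0; rewrite coefCM. Qed.

Lemma divides_mulX c p : divides c%:P (p * 'X) -> divides c%:P p.
Proof.
case=> q e; exists (drop_poly 1 q); apply: (mulIf (negbT (polyX_eq0 D))).
have q0 : c * q`_0 = 0.
  by have := congr1 (fun r : {poly D} => r`_0) e; rewrite coefMX coefCM.
rewrite e -[in LHS](poly_take_drop 1 q) expr1 mulrDr mulrA -[RHS]add0r; congr (_ + _).
apply/polyP=> i; rewrite coefCM coef_take_poly coef0.
by case: i => [|i] /=; rewrite ?mulr0.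
Qed.

(** Induction on both factors through their constant terms: [c] divides the product of these, hence
    one of them; that term is subtracted and X is divided out. *)
Lemma prime_polyC c : prime_elt c -> prime_elt c%:P.
Proof.
case=> c0 cU cP; split; rewrite ?polyC_eq0 //.
  apply: contra cU => /unitrP[q [e _]]; apply/unitrP; exists q`_0.
  have := congr1 (fun r : {poly D} => r`_0) e; rewrite coefMC coefC /=.
  by move=> {}e; split; rewrite // mulrC.
have dC x (d : {poly D}) : divides c x -> divides c%:P (x%:P * d).
  by case=> y ->; exists (y%:P * d); rewrite polyCM mulrA.
have dB (x y : {poly D}) : divides c%:P (x + y) -> divides c%:P y -> divides c%:P x.
  by move=> [u eu] [v ev]; exists (u - v); rewrite mulrBr -eu -ev addrK.
elim/poly_ind=> [b _|a x IHa]; first by left; exists 0; rewrite mulr0.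
elim/poly_ind=> [_|b y IHb h]; first by right; exists 0; rewrite mulr0.
have [|cx|cy] := cP x y.
- have := divides_polyC_coef h.
  by rewrite -!horner_coef0 !hornerE ?(mulr0, add0r).
- have : divides c%:P (a * (b * 'X + y%:P)).
    by apply: divides_mulX; rewrite mulrAC; apply: dB (dC x (b * 'X + y%:P) cx); rewrite -mulrDl.
  case/IHa=> [ha|]; last by right.
  left; apply: dividesD; first exact: divides_mulr.
  by case: cx => z ->; exists z%:P; rewrite polyCM.
- have : divides c%:P ((a * 'X + x%:P) * b).
    apply: divides_mulX; rewrite -mulrA.
    have hy := dC y (a * 'X + x%:P) cy.
    by apply: dB hy; rewrite [y%:P * _]mulrC -mulrDr.
  case/IHb=> [|hb]; first by left.
  right; apply: dividesD; first exact: divides_mulr.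
  by case: cy => z ->; exists z%:P; rewrite polyCM.
Qed.

Lemma prime_product_polyC m c : prime_product m c -> prime_product m c%:P.
Proof.
elim=> {m c} [u uU|m p a pp _ IH]; first by apply: PrimeProductUnit; apply: rmorph_unit.
by rewrite polyCM; apply: PrimeProductCons => //; apply: prime_polyC.
Qed.

Definition primitive p := forall c, prime_elt c -> ~ divides c%:P p.

(** Each prime of [c] stays prime as a constant polynomial, so it divides [a] or [b] and is
    cancelled there. A splitting over the fraction field thus yields a genuine one in the same
    degrees. *)
Lemma gauss_factor m c p a b : prime_product m c -> c%:P * p = a * b ->
  exists a' b', [/\ p = a' * b', size a' = size a & size b' = size b].
Proof.
move=> h; elim: h p a b => {m c} [u uU|m r c pr _ IH] p a b e.
  exists (u^-1%:P * a), b; split=> //.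
    by rewrite -mulrA -e mulrA -polyCM mulVr ?mul1r.
  by rewrite size_Cmul // invr_eq0; apply: contraTneq uU => ->; rewrite unitr0.
have [rP0 rPU rP] := prime_polyC pr; have [r0 _ _] := pr.
have [[a1 ea]|[b1 eb]] : divides r%:P a \/ divides r%:P b.
- by apply: rP; rewrite -e polyCM -mulrA; exists (c%:P * p).
- have [a' [b' [ep sa sb]]] : exists a' b', [/\ p = a' * b', size a' = size a1 & size b' = size b].
    by apply: IH; apply: (mulfI rP0); rewrite !mulrA -polyCM e ea.
  by exists a', b'; split=> //; rewrite sa ea size_Cmul.
- have [a' [b' [ep sa sb]]] : exists a' b', [/\ p = a' * b', size a' = size a & size b' = size b1].
    by apply: IH; apply: (mulfI rP0); rewrite mulrA -polyCM e eb mulrCA.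
  by exists a', b'; split=> //; rewrite sb eb size_Cmul.
Qed.

(** No prime of [c] divides the primitive [p], so each one is cancelled from [b]. *)
Lemma primitive_divides m c p a b :
  primitive p -> prime_product m c -> c%:P * a = p * b -> divides p a.
Proof.
move=> pp h; elim: h b => {m c} [u uU|m r c pr _ IH] b e.
  exists (u^-1%:P * b); rewrite mulrCA -e mulrA -polyCM mulVr ?mul1r //.
have [rP0 _ rP] := prime_polyC pr.
have [/pp|[b1 eb]] : divides r%:P p \/ divides r%:P b; last 2 [by []].
  by apply: rP; rewrite -e polyCM -mulrA; exists (c%:P * a).
by apply: (IH b1); apply: (mulfI rP0); rewrite mulrA -polyCM e eb mulrCA.
Qed.

(** Pulling a prime out of [p] also takes one out of its leading coefficient, so the extraction of
    the content terminates. *)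
Lemma primitive_part m p : prime_product m (lead_coef p) ->
  exists c p0 l, [/\ prime_product l c, primitive p0 & p = c%:P * p0].
Proof.
elim/ltn_ind: m p => m IH p h.
have [pp|npp] := classic (primitive p).
  by exists 1, p, 0; split; rewrite ?mul1r //; apply: PrimeProductUnit; apply: unitr1.
have [c pc [p1 ep]] : exists2 c, prime_elt c & divides c%:P p.
  apply: NNPP => nex; apply: npp => c pc dc; apply: nex; exists c => //.
have := h; rewrite ep lead_coefM lead_coefC => /(prime_product_cancel pc)[l lm].
case/(IH l lm)=> d [p0 [l' [hd pp0 e1]]].
exists (c * d), p0, l'.+1; split=> //; first exact: PrimeProductCons.
by rewrite e1 polyCM mulrA.
Qed.

Lemma poly_prime_factorizable : prime_factorizable D -> prime_factorizable {poly D}.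
Proof.
move=> fD p; have [n] := ubnP (size p); elim: n p => // n IH p sp p0.
have [|m] := fD (lead_coef p); first by rewrite lead_coef_eq0.
case/primitive_part => c [r [l [hc pr ep]]].
have [c0 r0] : c != 0 /\ r != 0.
  by move: p0; rewrite ep mulf_eq0 negb_or polyC_eq0 => /andP[].
have sr : size p = size r by rewrite ep size_Cmul.
suff [k hk] : exists k, prime_product k r.
  by exists (l + k); rewrite ep; apply: prime_productM => //; apply: prime_product_polyC.
have [r1|r1] := leqP (size r) 1.
  have er := size1_polyC r1; have [|k hk] := fD r`_0; first by rewrite -polyC_eq0 -er.
  by exists k; rewrite er; apply: prime_product_polyC.
have [[a [b [er sa sb]]]|irr] := classic (exists a b,
    [/\ r = a * b, (size a < size r)%N & (size b < size r)%N]).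
  have [a0 b0] : a != 0 /\ b != 0 by move: r0; rewrite er mulf_eq0 negb_or => /andP[].
  have [|i hi] := IH a _ a0; first by apply: leq_trans sa _; rewrite -ltnS -sr.
  have [|j hj] := IH b _ b0; first by apply: leq_trans sb _; rewrite -ltnS -sr.
  by exists (i + j); rewrite er; apply: prime_productM.
(* What remains is a primitive [r] of positive degree that does not split into lower degrees; it is
   itself prime. *)
exists 1; rewrite -[r]mulr1; apply: PrimeProductCons; last first.
  by apply: PrimeProductUnit; apply: unitr1.
(* [dvdp] is divisibility up to a nonzero scalar; primitivity of [r] removes the scalar. *)
have dvd_div a : Pdiv.Idomain.dvdp r a -> divides r a.
  case/Pdiv.Idomain.dvdpP=> [[d q]] /= /fD[i hi]; rewrite -mul_polyC [q * _]mulrC.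
  by move=> e; apply: primitive_divides pr hi e.
split=> //.
  apply: contraL r1 => /unitrP[q [_ e]]; rewrite -leqNgt.
  have q0 : q != 0 by apply: contra_eq_neq e => ->; rewrite mulr0 eq_sym oner_neq0.
  have := size_mul r0 q0; rewrite e size_poly1 => e1.
  suff: (size r <= (size r + size q).-1)%N by rewrite -e1.
  by rewrite -(prednK (n := size q)) ?lt0n ?size_poly_eq0 // addnS leq_addr.
move=> a b dab.
have Dab : Pdiv.Idomain.dvdp r (a * b).
  by case: dab => q ->; apply: Pdiv.Idomain.dvdp_mulr; apply: Pdiv.Idomain.dvdpp.
(* The gcd of [r] and [a] divides [r] up to a scalar, so [gauss_factor] gives r = q' g' with [g'] of
   the size of that gcd. As [r] does not split, [g'] is constant, and [r] divides [b], or it has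
   full degree, and [r] divides [a]. *)
have /Pdiv.Idomain.dvdpP[[d q] /= d0 e] := Pdiv.Idomain.dvdp_gcdl r a.
have [i hi] := fD d d0; move: e; rewrite -mul_polyC => /(gauss_factor hi)[q' [g' [er sq sg]]].
have [q'0 g'0] : q' != 0 /\ g' != 0 by move: r0; rewrite er mulf_eq0 negb_or => /andP[].
have sqg : size r = (size q' + size g').-1 by rewrite er size_mul.
have q's : (0 < size q')%N by rewrite lt0n size_poly_eq0.
have g's : (0 < size g')%N by rewrite lt0n size_poly_eq0.
have [gr|gr] := ltnP (size g') (size r).
  have [qr|qr] := ltnP (size q') (size r); first by case: irr; exists q', g'.
  have g1 : size g' = 1.
    apply/eqP; rewrite eqn_leq g's andbT -(leq_add2l (size q')) addn1.
    by apply: leq_trans (qr : (_ < _.+1)%N); rewrite sqg prednK // addn_gt0 q's.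
  have cop : Pdiv.Idomain.coprimep r a by rewrite Pdiv.Idomain.coprimep_def -sg g1.
  by right; apply: dvd_div; rewrite -(Pdiv.Idomain.Gauss_dvdpr b cop).
left; apply: dvd_div.
have : Pdiv.Idomain.gcdp r a \in [pred x | Pdiv.Idomain.eqp x r].
  rewrite inE -Pdiv.Idomain.dvdp_size_eqp ?Pdiv.Idomain.dvdp_gcdl // -sg eqn_leq gr andbT.
  by rewrite sqg -(prednK q's) addSn leq_addl.
by rewrite inE => h; rewrite -(Pdiv.Idomain.eqp_dvdl _ h) Pdiv.Idomain.dvdp_gcdr.
Qed.

End Gauss.

(** * Regular functions on open subsets of affine space *)

Lemma mpoly_gen_ind (R : comNzRingType) n (P : {mpoly R[n]} -> Prop) :
  (forall c, P c%:MP) -> (forall i, P 'X_i) ->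
  (forall p q, P p -> P q -> P (p + q)) ->
  (forall p q, P p -> P q -> P (p * q)) -> forall p, P p.
Proof.
move=> PC PX PD PM; elim/mpolyind=> [|c m p _ _ Pp]; first by rewrite -mpolyC0.
apply: (PD) => //; rewrite -mul_mpolyC; apply: (PM) => //.
rewrite mpolyXE_id; elim/big_ind: _ => // [|i _]; first exact: (PC 1).
by elim: (m i) => [|j IH]; [rewrite expr0; apply: (PC 1) | rewrite exprS; apply: PM].
Qed.

Lemma mpoly_rmorph_eq (R S : comNzRingType) n (f g : {rmorphism {mpoly R[n]} -> S}) :
  (forall c, f c%:MP = g c%:MP) -> (forall i, f 'X_i = g 'X_i) -> f =1 g.
Proof.
move=> eC eX; elim/mpoly_gen_ind=> // p q ep eq; first by rewrite !rmorphD ep eq.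
by rewrite !rmorphM ep eq.
Qed.

(** * Polynomials in n + 1 variables as univariate polynomials in the last one *)

Section Uni.
Variables (n : nat) (R : comNzRingType).

Lemma muniX (i : 'I_n.+1) : muni ('X_i : {mpoly R[n.+1]}) =
  match split (cast_ord (esym (addn1 n)) i) with
  | inl j => ('X_j)%:P
  | inr _ => 'X
  end.
Proof. by rewrite /muni mmapX mmap1U. Qed.

Definition mpoly_of_uni : {rmorphism {poly {mpoly R[n]}} -> {mpoly R[n.+1]}} :=
  horner_eval 'X_ord_max \o map_poly (@mwiden n R).

Lemma muni_widen (p : {mpoly R[n]}) : muni (mwiden p) = p%:P.
Proof.
pose f : {rmorphism {mpoly R[n]} -> {poly {mpoly R[n]}}} := @muni n R \o @mwiden n R.
apply: (@mpoly_rmorph_eq _ _ _ f polyC) => [c|i] /=; first by rewrite mwidenC muniC.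
rewrite mwidenX mnmwiden1 muniX; case: splitP => [j|j] /= e.
  by congr (('X__)%:P); apply: val_inj.
by have := ltn_ord i; rewrite e ltnNge leq_addr.
Qed.

Lemma muniK : cancel (@muni n R) mpoly_of_uni.
Proof.
pose f : {rmorphism {mpoly R[n.+1]} -> {mpoly R[n.+1]}} := mpoly_of_uni \o @muni n R.
apply: (@mpoly_rmorph_eq _ _ _ f idfun) => [c|i] /=.
  by rewrite muniC map_polyC horner_evalE hornerC /= mwidenC.
rewrite muniX; case: splitP => [j|j] /= e.
  rewrite map_polyC horner_evalE hornerC /= mwidenX mnmwiden1.
  by congr 'X__; apply: val_inj.
rewrite map_polyX horner_evalE hornerX; congr 'X__; apply: val_inj => /=.
by rewrite e ord1 addn0.
Qed.

Lemma mpoly_of_uniK : cancel mpoly_of_uni (@muni n R).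
Proof.
elim/poly_ind=> [|p c IH]; first by rewrite !rmorph0.
rewrite rmorphD rmorphM rmorphD rmorphM /= IH map_polyX map_polyC !horner_evalE.
rewrite hornerX hornerC muni_widen muniX; congr (_ * _ + _).
by case: splitP => // j /= e; have := ltn_ord j; rewrite -e ltnn.
Qed.

Lemma meval_muni (v : 'I_n.+1 -> R) (p : {mpoly R[n.+1]}) :
  (map_poly (meval (fun i => v (widen_ord (leqnSn n) i))) (muni p)).[v ord_max] = p.@[v].
Proof.
pose f : {rmorphism {mpoly R[n.+1]} -> R} :=
  horner_eval (v ord_max) \o map_poly (meval (fun i => v (widen_ord (leqnSn n) i)))
   \o @muni n R.
apply: (@mpoly_rmorph_eq _ _ _ f (meval v)) => [c|i] /=.
  by rewrite muniC map_polyC horner_evalE hornerC /= !mevalC.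
rewrite muniX mevalXU; case: splitP => [j|j] /= e.
  rewrite map_polyC horner_evalE hornerC /= mevalXU.
  by congr v; apply: val_inj.
rewrite map_polyX horner_evalE hornerX; congr v; apply: val_inj => /=.
by rewrite e ord1 addn0.
Qed.

End Uni.

Lemma mpoly_prime_factorizable (k : fieldType) n : prime_factorizable {mpoly k[n]}.
Proof.
elim: n => [|n IH].
  apply: (@prime_factorizable_iso {mpoly k[0]} k (@mcoeff 0 k 0) (@mpolyC 0 k)).
  - apply: (@mpoly_rmorph_eq _ _ _ (@mpolyC 0 k \o @mcoeff 0 k 0) idfun) => [c|[]//] /=.
    by rewrite mcoeffC eqxx mulr1.
  - by move=> c /=; rewrite mcoeffC eqxx mulr1.
  - exact: field_prime_factorizable.
apply: (prime_factorizable_iso (@muniK n k) (@mpoly_of_uniK n k)).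
exact: poly_prime_factorizable.
Qed.

Section Evaluation.
Variable k : closedFieldType.

(** By induction the leading coefficient in the last variable is nonzero somewhere; the resulting
    univariate polynomial has a nonroot, as k is algebraically closed. *)
Lemma meval_neq0 n (p : {mpoly k[n]}) : p != 0 -> exists v : 'I_n -> k, p.@[v] != 0.
Proof.
elim: n p => [|n IH] p p0.
  exists (fun=> 0); apply: contra p0 => /eqP e.
  have ep : p = (p.@[fun=> 0])%:MP.
    apply: (@mpoly_rmorph_eq _ _ _ idfun (@mpolyC 0 k \o meval (fun=> 0))) => [c|[]] //=.
    by rewrite mevalC.
  by rewrite ep e.
have /IH[v hv] : lead_coef (muni p) != 0.
  by rewrite lead_coef_eq0; apply: contra p0 => /eqP e; rewrite -[p]muniK e rmorph0.
have /closed_nonrootP[t ht] : map_poly (meval v) (muni p) != 0.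
  by apply: contra hv => /eqP/polyP/(_ (size (muni p)).-1); rewrite coef_map coef0 => ->.
pose w (i : 'I_n.+1) := if split (cast_ord (esym (addn1 n)) i) is inl j then v j else t.
exists w; rewrite -meval_muni; apply: contra ht => /eqP e; apply/rootP; rewrite -[RHS]e.
congr horner; last by rewrite /w; case: splitP => // j /= ej; have := ltn_ord j; rewrite -ej ltnn.
apply: eq_map_poly => q; apply: meval_eq => i; rewrite /w; case: splitP => j /= e'.
  by congr v; apply: val_inj.
by have := ltn_ord i; rewrite e' ltnNge leq_addr.
Qed.

Lemma ev_eq0 n (p : {mpoly k[n]}) : (forall x, ev p x = 0) -> p = 0.
Proof.
move=> h; apply/eqP/negPn/negP => /meval_neq0[v /eqP]; apply.
by rewrite -[RHS](h (\row_i v i)) /ev; apply: meval_eq => i; rewrite mxE.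
Qed.

Lemma evC n c (x : 'rV[k]_n) : ev c%:MP x = c. Proof. exact: mevalC. Qed.
Lemma evX n i (x : 'rV[k]_n) : ev 'X_i x = x 0 i. Proof. exact: mevalXU. Qed.
Lemma ev0 n (x : 'rV[k]_n) : ev 0 x = 0. Proof. exact: meval0. Qed.
Lemma ev1 n (x : 'rV[k]_n) : ev 1 x = 1. Proof. exact: meval1. Qed.
Lemma evD n p q (x : 'rV[k]_n) : ev (p + q) x = ev p x + ev q x. Proof. exact: mevalD. Qed.
Lemma evN n p (x : 'rV[k]_n) : ev (- p) x = - ev p x. Proof. exact: mevalN. Qed.
Lemma evB n p q (x : 'rV[k]_n) : ev (p - q) x = ev p x - ev q x. Proof. exact: mevalB. Qed.
Lemma evM n p q (x : 'rV[k]_n) : ev (p * q) x = ev p x * ev q x. Proof. exact: mevalM. Qed.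
Lemma evXn n p m (x : 'rV[k]_n) : ev (p ^+ m) x = ev p x ^+ m. Proof. exact: rmorphXn. Qed.
Definition evE := (evC, evX, ev0, ev1, evD, evN, evB, evM, evXn).

Definition msubst n m (g : 'I_n -> {mpoly k[m]}) : {rmorphism {mpoly k[n]} -> {mpoly k[m]}} :=
  mmap (@mpolyC m k) g.

Lemma msubstX n m (g : 'I_n -> {mpoly k[m]}) i : msubst g 'X_i = g i.
Proof. by rewrite /= mmapX mmap1U. Qed.

Lemma ev_msubst n m (g : 'I_n -> {mpoly k[m]}) p x :
  ev (msubst g p) x = ev p (\row_i ev (g i) x).
Proof.
pose e l (y : 'rV[k]_l) : {rmorphism {mpoly k[l]} -> k} := meval (fun i => y 0 i).
apply: (@mpoly_rmorph_eq _ _ _ (e m x \o msubst g) (e n (\row_i ev (g i) x))) => [c|i] /=.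
  by rewrite mmapC !mevalC.
by rewrite mmapX mmap1U mevalXU mxE.
Qed.

(** On the line through [x] and [y] the polynomial becomes univariate without roots, hence
    constant. *)
Lemma ev_nonvanishing n (p : {mpoly k[n]}) x y : (forall z, ev p z != 0) -> ev p x = ev p y.
Proof.
move=> h; pose l i : {poly k} := (x 0 i)%:P + (y 0 i - x 0 i)%:P * 'X.
pose q := mmap (@polyC k) l p.
have qE t : q.[t] = ev p (\row_i (l i).[t]).
  pose f : {rmorphism {mpoly k[n]} -> k} := horner_eval t \o mmap (@polyC k) l.
  apply: (@mpoly_rmorph_eq _ _ _ f (meval (fun i => (\row_i (l i).[t] : 'rV_n) 0 i))) => [c|i] /=.
    by rewrite mmapC horner_evalE hornerC mevalC.
  by rewrite mmapX mmap1U mevalXU mxE horner_evalE.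
have /size_poly1P[c c0 qc] : size q == 1.
  apply/negPn/negP => /closed_rootP[t /rootP]; rewrite qE => /eqP e.
  by have := h (\row_i (l i).[t]); rewrite e.
have -> : x = \row_i (l i).[0] by apply/rowP=> i; rewrite mxE !hornerE.
have -> : y = \row_i (l i).[1]
  by apply/rowP=> i; rewrite mxE hornerD hornerC hornerCM hornerX mulr1 subrKC.
by rewrite -!qE qc !hornerC.
Qed.

Lemma open_basic n (U : subset_of_space k n) a : zariski_open U -> U a ->
  exists2 g, ev g a != 0 & forall x, ev g x != 0 -> U x.
Proof.
case=> S hS Ua; apply: NNPP => nex; apply: (proj2 (hS a) _ Ua) => g Sg.
apply/eqP/negPn/negP => ga; apply: nex; exists g => // x gx; apply: NNPP => /(hS x)/(_ g Sg) e.
by rewrite e eqxx in gx.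
Qed.

Lemma basic_open n (g : {mpoly k[n]}) : zariski_open (fun x => ev g x != 0).
Proof.
exists (eq g) => x; split; first by move=> /negP/negPn/eqP e p <-.
by move=> /(_ g erefl) ->; rewrite eqxx.
Qed.

Lemma zariski_openT n : zariski_open (fun _ : 'rV[k]_n => True).
Proof.
exists (eq 1) => x; split=> [//|/(_ 1 erefl)]; rewrite ev1 => /eqP.
by rewrite oner_eq0.
Qed.

Lemma ev_eq0_on n (U : subset_of_space k n) (p : {mpoly k[n]}) : zariski_open U ->
  (exists x, U x) -> (forall x, U x -> ev p x = 0) -> p = 0.
Proof.
move=> oU [a /(open_basic oU)[g ga gU]] h.
have /eqP : p * g = 0.
  apply: ev_eq0 => x; rewrite evM; have [->|/gU/h ->] := eqVneq (ev g x) 0.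
    by rewrite mulr0.
  by rewrite mul0r.
by rewrite mulf_eq0 => /orP[/eqP //|/eqP g0]; move: ga; rewrite g0 ev0 eqxx.
Qed.

(** Multiplying numerator and denominator by a polynomial that cuts out a smaller neighbourhood lets
    the denominator itself define the neighbourhood. *)
Lemma regular_atP n (V : subset_of_space k n) f a : V a ->
  regular_at V f a <->
  exists p q, ev q a != 0 /\ forall x, V x -> ev q x != 0 -> f x = ev p x / ev q x.
Proof.
move=> Va; split; last first.
  move=> [p [q [qa h]]]; exists (fun x => ev q x != 0), p, q; split=> //.
  - exact: basic_open.
  - by move=> x Vx qx; split; rewrite ?h.
move=> [U [p [q [oU Ua h]]]]; have [g ga gU] := open_basic oU Ua.
exists (p * g), (q * g); split; first by rewrite evM mulf_neq0 //; case: (h a).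
move=> x Vx; rewrite !evM mulf_eq0 negb_or => /andP[qx gx].
by have [_ ->] := h x Vx (gU x gx); rewrite -mulf_div divff ?mulr1.
Qed.

(** Every local expression p'/q' is the same rational function as the reduced fraction p0/q0, so
    [q0] divides every local denominator [q'] and cannot vanish on [U]. *)
Lemma regular_fraction n (U : subset_of_space k n) f :
  zariski_open U -> (exists x, U x) -> (forall a, U a -> regular_at U f a) ->
  exists p q, forall x, U x -> ev q x != 0 /\ f x = ev p x / ev q x.
Proof.
move=> oU [a0 Ua0] reg.
have [p1 [q1 [q1a h1]]] := proj1 (regular_atP _ Ua0) (reg a0 Ua0).
have neq0 q a : ev q a != 0 -> q != 0 :> {mpoly k[n]}.
  by apply: contraNneq => ->; rewrite ev0.
have q1n := neq0 _ _ q1a.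
have [p0 [q0 [q0n e01 low]]] := lowest_terms (@mpoly_prime_factorizable k n) p1 q1n.
exists p0, q0 => a Ua.
have [p' [q' [q'a h']]] := proj1 (regular_atP _ Ua) (reg a Ua).
have q'n := neq0 _ _ q'a.
have e' : p1 * q' = p' * q1.
  apply/eqP; rewrite -subr_eq0; apply/eqP.
  (* The factor [q1 * q'] absorbs the points where one of the two expressions is undefined. *)
  have /eqP : (p1 * q' - p' * q1) * (q1 * q') = 0.
    apply: (@ev_eq0_on n U) => //; first by exists a0.
    move=> x Ux; rewrite !evE.
    have [->|q1x] := eqVneq (ev q1 x) 0; first by rewrite mul0r mulr0.
    have [->|q'x] := eqVneq (ev q' x) 0; first by rewrite !mulr0.
    have /eqP := h1 x Ux q1x; rewrite (h' x Ux q'x) eqr_div // => /eqP ->.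
    by rewrite subrr mul0r.
  by rewrite mulf_eq0 mulf_eq0 (negPf q1n) (negPf q'n) !orbF => /eqP.
have [c ec] := low _ _ e'.
have q0a : ev q0 a != 0 by move: q'a; rewrite ec evM mulf_eq0 negb_or => /andP[].
split=> //; rewrite (h' a Ua q'a); apply/eqP; rewrite eqr_div // -!evM; apply/eqP.
congr ev; apply: (mulfI q1n).
transitivity (p1 * q0 * q'); last by rewrite e01; ring.
by transitivity (p' * q1 * q0); [ring | rewrite -e'; ring].
Qed.

Lemma regular_polynomial n (f : 'rV[k]_n -> k) :
  (forall a, regular_at (fun=> True) f a) -> exists p, forall x, f x = ev p x.
Proof.
move=> reg; have [| |p [q h]] := @regular_fraction n (fun=> True) f (@zariski_openT n).
- by exists 0.
- by move=> a _; apply: reg.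
pose c := ev q 0; exists (p * c^-1%:MP) => x; rewrite !evE.
have [_ ->] := h x I; congr (_ / _); apply: ev_nonvanishing => z; by case: (h z I).
Qed.

End Evaluation.

(** * The invariant 3-form *)

Section MaurerCartan.
Variable C : comNzRingType.

Record derivation (D : C -> C) : Prop := Derivation {
  derD : forall x y, D (x + y) = D x + D y;
  derM : forall x y, D (x * y) = D x * y + x * D y }.

Lemma der0 D : derivation D -> D 0 = 0.
Proof. by move=> hD; apply: (addIr (D 0)); rewrite -(derD hD) !add0r. Qed.

Lemma der1 D : derivation D -> D 1 = 0.
Proof.
move=> hD; apply: (addIr (D 1)); rewrite add0r -{3}[1]mulr1 (derM hD).
by rewrite mulr1 mul1r.
Qed.

Lemma derN D (hD : derivation D) x : D (- x) = - D x.
Proof. by apply/eqP; rewrite -addr_eq0 -(derD hD) addNr (der0 hD). Qed.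

Lemma derB D (hD : derivation D) x y : D (x - y) = D x - D y.
Proof. by rewrite (derD hD) (derN hD). Qed.

Variables a b c d : C.

(* The entries of g^-1 * D g = (mc1, mc2; mc3, - mc1) for g = (a, b; c, d). *)
Definition mc1 (D : C -> C) := d * D a - b * D c.
Definition mc2 (D : C -> C) := d * D b - b * D d.
Definition mc3 (D : C -> C) := a * D c - c * D a.

Definition det3 (x1 x2 x3 y1 y2 y3 z1 z2 z3 : C) :=
  x1 * (y2 * z3 - y3 * z2) - x2 * (y1 * z3 - y3 * z1) + x3 * (y1 * z2 - y2 * z1).

(** The wedge of the three Maurer-Cartan forms evaluated on [e], [f], [h]: the pullback of the
    invariant volume form along the matrix of functions. *)
Definition mc_volume e f h :=
  det3 (mc1 e) (mc2 e) (mc3 e) (mc1 f) (mc2 f) (mc3 f) (mc1 h) (mc2 h) (mc3 h).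

Hypothesis det1 : a * d - b * c = 1.

Lemma der_det D : derivation D -> a * D d + d * D a - b * D c - c * D b = 0.
Proof.
move=> hD; transitivity (D (a * d - b * c)); last by rewrite det1 der1.
by rewrite (derB hD) !(derM hD); ring.
Qed.

Section Structure.
Variables D1 D2 D12 : C -> C.
Hypotheses (h1 : derivation D1) (h2 : derivation D2).
Hypothesis bracket : forall x, D1 (D2 x) = D2 (D1 x) + D12 x.

(** The Maurer-Cartan equation d omega = - omega ^ omega in its diagonal entry, evaluated on [D1]
    and [D2] with bracket [D12]; the next two lemmas are the off-diagonal entries. *)
Lemma mc1_structure :
  D1 (mc1 D2) = D2 (mc1 D1) + mc1 D12 - (mc2 D1 * mc3 D2 - mc3 D1 * mc2 D2).
Proof.
rewrite /mc1 /mc2 /mc3 !(derB h1, derB h2) !(derM h1, derM h2) !bracket.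
apply/eqP; rewrite -subr_eq0; apply/eqP.
have e1 := der_det h1; have e2 := der_det h2.
(* The defect is an explicit combination of the relations det = 1 and [der_det] for [D1] and
   [D2]. *)
transitivity ((1 - (a * d - b * c)) *
    (D1 d * D2 a - D2 d * D1 a - (D1 b * D2 c - D2 b * D1 c))
  + (a * D1 d + d * D1 a - b * D1 c - c * D1 b) * (d * D2 a - b * D2 c)
  - (a * D2 d + d * D2 a - b * D2 c - c * D2 b) * (d * D1 a - b * D1 c)); first by ring.
by rewrite e1 e2 det1; ring.
Qed.

Lemma mc2_structure :
  D1 (mc2 D2) = D2 (mc2 D1) + mc2 D12 - 2 * (mc1 D1 * mc2 D2 - mc2 D1 * mc1 D2).
Proof.
rewrite /mc1 /mc2 !(derB h1, derB h2) !(derM h1, derM h2) !bracket.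
apply/eqP; rewrite -subr_eq0; apply/eqP.
have e1 := der_det h1; have e2 := der_det h2.
transitivity ((1 - (a * d - b * c)) * (2 * (D1 d * D2 b - D2 d * D1 b))
  + 2 * (a * D1 d + d * D1 a - b * D1 c - c * D1 b) * (d * D2 b - b * D2 d)
  - 2 * (a * D2 d + d * D2 a - b * D2 c - c * D2 b) * (d * D1 b - b * D1 d));
  first by ring.
by rewrite e1 e2 det1; ring.
Qed.

Lemma mc3_structure :
  D1 (mc3 D2) = D2 (mc3 D1) + mc3 D12 - 2 * (mc3 D1 * mc1 D2 - mc1 D1 * mc3 D2).
Proof.
rewrite /mc1 /mc3 !(derB h1, derB h2) !(derM h1, derM h2) !bracket.
apply/eqP; rewrite -subr_eq0; apply/eqP.
transitivity ((1 - (a * d - b * c)) * (2 * (D1 a * D2 c - D2 a * D1 c))); first by ring.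
by rewrite det1; ring.
Qed.

End Structure.

Section Homotopy.
Variables e f h dt : C -> C.
Hypotheses (he : derivation e) (hf : derivation f) (hh : derivation h) (hdt : derivation dt).
Hypotheses (ef : forall x, e (f x) = f (e x) + h x)
           (ehe : forall x, h (e x) = e (h x) + 2 * e x)
           (ehf : forall x, h (f x) = f (h x) - 2 * f x)
           (te : forall x, dt (e x) = e (dt x))
           (tf : forall x, dt (f x) = f (dt x))
           (th : forall x, dt (h x) = h (dt x)).

(* The pullback of the closed invariant 3-form along a one-parameter family of maps
   to SL_2 varies by an exact form. *)
Lemma mc_volume_homotopy : dt (mc_volume e f h) =
    e (det3 (mc1 dt) (mc2 dt) (mc3 dt) (mc1 f) (mc2 f) (mc3 f) (mc1 h) (mc2 h) (mc3 h))
  + f (det3 (mc1 e) (mc2 e) (mc3 e) (mc1 dt) (mc2 dt) (mc3 dt) (mc1 h) (mc2 h) (mc3 h))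
  + h (det3 (mc1 e) (mc2 e) (mc3 e) (mc1 f) (mc2 f) (mc3 f) (mc1 dt) (mc2 dt) (mc3 dt)).
Proof.
have te0 x : dt (e x) = e (dt x) + 0 by rewrite addr0.
have tf0 x : dt (f x) = f (dt x) + 0 by rewrite addr0.
have th0 x : dt (h x) = h (dt x) + 0 by rewrite addr0.
have ehf' x : h (f x) = f (h x) + (- (2 * f x)) by [].
have m2e : [/\ mc1 (fun x => 2 * e x) = 2 * mc1 e, mc2 (fun x => 2 * e x) = 2 * mc2 e
             & mc3 (fun x => 2 * e x) = 2 * mc3 e] by split; rewrite /mc1 /mc2 /mc3; ring.
have m2f : [/\ mc1 (fun x => - (2 * f x)) = - (2 * mc1 f),
               mc2 (fun x => - (2 * f x)) = - (2 * mc2 f)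
             & mc3 (fun x => - (2 * f x)) = - (2 * mc3 f)] by split; rewrite /mc1 /mc2 /mc3; ring.
have m0 : [/\ mc1 (fun=> 0) = 0, mc2 (fun=> 0) = 0 & mc3 (fun=> 0) = 0].
  by split; rewrite /mc1 /mc2 /mc3; ring.
case: m2e m2f m0 => [a1 a2 a3] [b1 b2 b3] [c1 c2 c3].
have s1 := mc1_structure hdt he te0; have s2 := mc2_structure hdt he te0.
have s3 := mc3_structure hdt he te0; have s4 := mc1_structure hdt hf tf0.
have s5 := mc2_structure hdt hf tf0; have s6 := mc3_structure hdt hf tf0.
have s7 := mc1_structure hdt hh th0; have s8 := mc2_structure hdt hh th0.
have s9 := mc3_structure hdt hh th0.
have r1 := mc1_structure he hf ef; have r2 := mc2_structure he hf ef.
have r3 := mc3_structure he hf ef; have r4 := mc1_structure hh he ehe.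
have r5 := mc2_structure hh he ehe; have r6 := mc3_structure hh he ehe.
have r7 := mc1_structure hh hf ehf'; have r8 := mc2_structure hh hf ehf'.
have r9 := mc3_structure hh hf ehf'.
move: s1 s2 s3 s4 s5 s6 s7 s8 s9 r1 r2 r3 r4 r5 r6 r7 r8 r9.
rewrite a1 a2 a3 b1 b2 b3 c1 c2 c3 /mc_volume.
move: (mc1 e) (mc2 e) (mc3 e) (mc1 f) (mc2 f) (mc3 f) (mc1 h) (mc2 h) (mc3 h)
  (mc1 dt) (mc2 dt) (mc3 dt) => E1 E2 E3 F1 F2 F3 H1 H2 H3 T1 T2 T3.
move=> s1 s2 s3 s4 s5 s6 s7 s8 s9 r1 r2 r3 r4 r5 r6 r7 r8 r9.
rewrite /det3 !(derD he, derD hf, derD hh, derD hdt, derB he, derB hf, derB hh, derB hdt).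
rewrite !(derN he, derN hf, derN hh, derN hdt).
rewrite !(derM he, derM hf, derM hh, derM hdt, derB he, derB hf, derB hh, derB hdt).
(* The structure equations exchange the order of differentiation. The bracket terms cancel because
   sl_2 is unimodular, and an identity in free variables is left. *)
rewrite s1 s2 s3 s4 s5 s6 s7 s8 s9 r1 r2 r3 r4 r5 r6 r7 r8 r9.
move: (f E1) (f E2) (f E3) (e H1) (e H2) (e H3) (f H1) (f H2) (f H3)
  (e T1) (e T2) (e T3) (f T1) (f T2) (f T3) (h T1) (h T2) (h T3).
move=> *; ring.
Qed.

End Homotopy.
End MaurerCartan.

(** * Integration over SU(2) *)

Section MonomialExtension.
Variables (k : fieldType) (n : nat) (V : lmodType k) (u : 'X_{1..n} -> V).

Definition mextend (p : {mpoly k[n]}) : V := \sum_(m <- msupp p) p@_m *: u m.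

Lemma mextend_wide j p : (msize p <= j)%N ->
  mextend p = \sum_(m : 'X_{1..n < j}) p@_m *: u m.
Proof.
move=> hj; pose I : subFinType _ := 'X_{1..n < j}.
rewrite /mextend (big_mksub I) /=; first last.
- by move=> m /msize_mdeg_lt /leq_trans; apply.
- exact: msupp_uniq.
by rewrite big_rmcond //= => m /memN_msupp_eq0 ->; rewrite scale0r.
Qed.

Lemma mextend_is_linear : linear mextend.
Proof.
move=> c p q; pose j := maxn (msize (c *: p + q)) (maxn (msize p) (msize q)).
rewrite !(@mextend_wide j) ?leq_max ?leqnn ?orbT // scaler_sumr -big_split /=.
by apply: eq_bigr => m _; rewrite mcoeffD mcoeffZ scalerDl scalerA.
Qed.

HB.instance Definition _ :=
  GRing.isLinear.Build k {mpoly k[n]} V *:%R mextend mextend_is_linear.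

Lemma mextendX m : mextend 'X_[m] = u m.
Proof. by rewrite /mextend msuppX big_seq1 mcoeffX eqxx scale1r. Qed.

End MonomialExtension.

Section Integral.
Variable k : closedFieldType.
Hypothesis hk : [pchar k] =i pred0.

Lemma natS_neq0 i : i.+1%:R != 0 :> k.
Proof. by rewrite (proj1 (pcharf0P k) hk). Qed.

Lemma fact_neq0 i : (i`!)%:R != 0 :> k.
Proof. by rewrite (proj1 (pcharf0P k) hk) -lt0n fact_gt0. Qed.

(* The integral of a^i b^j c^l d^m over the compact form SU(2). *)
Definition haar (i j l m : nat) : k :=
  if (i == m) && (j == l) then (-1) ^+ j * (i`!)%:R * (j`!)%:R / ((i + j).+1`!)%:R else 0.

(** The identity (i + 1) + (j + 1) = i + j + 2 on factorials; it makes the functional compatible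
    with ad - bc = 1. *)
Lemma haar_det i j l m : haar i.+1 j l m.+1 - haar i j.+1 l.+1 m = haar i j l m.
Proof.
rewrite /haar !eqSS; case: ifP => // _; last by rewrite subrr.
have h0 := fact_neq0 (i + j); have := natS_neq0 (i + j); have := natS_neq0 (i + j).+1.
rewrite addSn addnS !factS !natrM exprS -!natr1 !natrD => h2 h1.
by field; rewrite h0 h1 h2.
Qed.

(** The integral of the derivative of a^i b^j c^l d^m along e. A truncated predecessor of 0 is
    harmless, since its coefficient is 0. *)
Lemma haar_e i j l m :
  j%:R * haar i.+1 j.-1 l m + m%:R * haar i j l.+1 m.-1 = 0.
Proof.
case: j m => [|j] [|m] /=; rewrite ?mul0r ?add0r ?addr0 //.
- by rewrite /haar /= andbF mulr0.
- by rewrite /haar /= mulr0.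
- rewrite /haar !eqSS; case: ifP => [/andP[/eqP -> /eqP ->]|_]; last by rewrite !mulr0 addr0.
  by rewrite !factS addSn addnS !natrM exprS; ring.
Qed.

Lemma haar_f i j l m :
  i%:R * haar i.-1 j.+1 l m + l%:R * haar i j l.-1 m.+1 = 0.
Proof.
case: i l => [|i] [|l] /=; rewrite ?mul0r ?add0r ?addr0 //.
- by rewrite /haar /= mulr0.
- by rewrite /haar /= andbF mulr0.
- rewrite /haar !eqSS; case: ifP => [/andP[/eqP -> /eqP ->]|_]; last by rewrite !mulr0 addr0.
  by rewrite !factS addSn addnS !natrM exprS; ring.
Qed.

End Integral.

Local Notation va := (@Ordinal 5 0 isT).
Local Notation vb := (@Ordinal 5 1 isT).
Local Notation vc := (@Ordinal 5 2 isT).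
Local Notation vd := (@Ordinal 5 3 isT).
Local Notation vt := (@Ordinal 5 4 isT).

Lemma ord5_ind (P : 'I_5 -> Prop) : P va -> P vb -> P vc -> P vd -> P vt -> forall i, P i.
Proof.
move=> Pa Pb Pc Pd Pt [[|[|[|[|[|//]]]]] h].
- by rewrite (_ : Ordinal h = va) //; apply: val_inj.
- by rewrite (_ : Ordinal h = vb) //; apply: val_inj.
- by rewrite (_ : Ordinal h = vc) //; apply: val_inj.
- by rewrite (_ : Ordinal h = vd) //; apply: val_inj.
- by rewrite (_ : Ordinal h = vt) //; apply: val_inj.
Qed.

Lemma mderivXU (R : comNzRingType) n (i j : 'I_n) :
  ('X_i : {mpoly R[n]})^`M(j) = (i == j)%:R.
Proof.
rewrite mderivX mnm1E; case: eqP => [->|_]; last by rewrite scale0r.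
by rewrite scale1r -{1}[U_(j)%MM]add0m addmK mpolyX0.
Qed.

(** * Invariant vector fields of SL_2, and integration with a parameter t *)

Section Functional.
Variable k : closedFieldType.
Hypothesis hk : [pchar k] =i pred0.
Local Notation B := {mpoly k[5]}.
Implicit Types p q r : B.

(* B = k[a, b, c, d, t]; De, Df, Dh are the left-invariant vector fields of SL_2. *)
Definition De p : B := 'X_va * p^`M(vb) + 'X_vc * p^`M(vd).
Definition Df p : B := 'X_vb * p^`M(va) + 'X_vd * p^`M(vc).
Definition Dh p : B :=
  'X_va * p^`M(va) - 'X_vb * p^`M(vb) + ('X_vc * p^`M(vc) - 'X_vd * p^`M(vd)).
Definition Dt p : B := p^`M(vt).
Definition delta : B := 'X_va * 'X_vd - 'X_vb * 'X_vc - 1.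

Lemma De_derivation : derivation De.
Proof. by split=> p q; rewrite /De !(mderivD, mderivM); ring. Qed.
Lemma Df_derivation : derivation Df.
Proof. by split=> p q; rewrite /Df !(mderivD, mderivM); ring. Qed.
Lemma Dh_derivation : derivation Dh.
Proof. by split=> p q; rewrite /Dh !(mderivD, mderivM); ring. Qed.
Lemma Dt_derivation : derivation Dt.
Proof. by split=> p q; rewrite /Dt !(mderivD, mderivM). Qed.

Lemma De_const c : De c%:MP = 0. Proof. by rewrite /De !mderivC !mulr0 addr0. Qed.
Lemma Df_const c : Df c%:MP = 0. Proof. by rewrite /Df !mderivC !mulr0 addr0. Qed.
Lemma Dh_const c : Dh c%:MP = 0.
Proof. by rewrite /Dh !mderivC !mulr0 !subr0 addr0. Qed.
Lemma Dt_const c : Dt c%:MP = 0. Proof. exact: mderivC. Qed.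

Lemma De_var : (De 'X_va = 0) * (De 'X_vb = 'X_va)
  * (De 'X_vc = 0) * (De 'X_vd = 'X_vc) * (De 'X_vt = 0).
Proof. by rewrite /De !mderivXU /= !(mulr0, mulr1, addr0, add0r). Qed.
Lemma Df_var : (Df 'X_va = 'X_vb) * (Df 'X_vb = 0)
  * (Df 'X_vc = 'X_vd) * (Df 'X_vd = 0) * (Df 'X_vt = 0).
Proof. by rewrite /Df !mderivXU /= !(mulr0, mulr1, addr0, add0r). Qed.
Lemma Dh_var : (Dh 'X_va = 'X_va) * (Dh 'X_vb = - 'X_vb)
  * (Dh 'X_vc = 'X_vc) * (Dh 'X_vd = - 'X_vd) * (Dh 'X_vt = 0).
Proof. by rewrite /Dh !mderivXU /= !(mulr0, mulr1, addr0, add0r, subr0, sub0r, oppr0). Qed.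
Lemma Dt_var : (Dt 'X_va = 0) * (Dt 'X_vb = 0)
  * (Dt 'X_vc = 0) * (Dt 'X_vd = 0) * (Dt 'X_vt = 1).
Proof. by rewrite /Dt !mderivXU /=. Qed.

(** A commutator of derivations is a derivation, so it suffices to compare on the variables. *)
Lemma bracket_gen D1 D2 D12 : derivation D1 -> derivation D2 -> derivation D12 ->
  (forall c, D1 c%:MP = 0) -> (forall c, D2 c%:MP = 0) -> (forall c, D12 c%:MP = 0) ->
  (forall i, D1 (D2 'X_i) = D2 (D1 'X_i) + D12 'X_i) ->
  forall p : B, D1 (D2 p) = D2 (D1 p) + D12 p.
Proof.
move=> h1 h2 h12 c1 c2 c12 hX; elim/mpoly_gen_ind=> [c|//|p q ep eq|p q ep eq].
- by rewrite c1 c2 c12 (der0 h1) (der0 h2) addr0.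
- by rewrite !(derD h1, derD h2, derD h12) ep eq; ring.
- by rewrite !(derM h1, derM h2, derM h12, derD h1, derD h2) ep eq; ring.
Qed.

Lemma derivation0 : derivation (fun=> 0 : B).
Proof. by split=> *; rewrite ?(mul0r, mulr0, addr0). Qed.

Lemma derivation_mul c D : derivation D -> derivation (fun x : B => c * D x).
Proof. by move=> hD; split=> x y; rewrite ?(derD hD) ?(derM hD); ring. Qed.

Definition varE := (De_var, Df_var, Dh_var, Dt_var).

Lemma De_Df p : De (Df p) = Df (De p) + Dh p.
Proof.
apply: (bracket_gen De_derivation Df_derivation Dh_derivation De_const Df_const Dh_const).
by elim/ord5_ind; rewrite !varE ?(der0 De_derivation) ?(der0 Df_derivation); ring.
Qed.

Lemma Dh_De p : Dh (De p) = De (Dh p) + 2 * De p.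
Proof.
apply: (bracket_gen Dh_derivation De_derivation (derivation_mul 2 De_derivation)
  Dh_const De_const) => [c|]; first by rewrite De_const mulr0.
by elim/ord5_ind; rewrite !varE ?(derN De_derivation) ?(derN Dh_derivation)
  ?(der0 De_derivation) ?(der0 Dh_derivation) ?varE; ring.
Qed.

Lemma Dh_Df p : Dh (Df p) = Df (Dh p) - 2 * Df p.
Proof.
rewrite -mulNr.
apply: (bracket_gen Dh_derivation Df_derivation (derivation_mul (- 2) Df_derivation)
  Dh_const Df_const) => [c|]; first by rewrite Df_const mulr0.
by elim/ord5_ind; rewrite !varE ?(derN Df_derivation) ?(derN Dh_derivation)
  ?(der0 Df_derivation) ?(der0 Dh_derivation) ?varE; ring.
Qed.

Lemma Dt_comm D : derivation D -> (forall c, D c%:MP = 0) ->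
  (forall i, Dt (D 'X_i) = D (Dt 'X_i)) -> forall p, Dt (D p) = D (Dt p).
Proof.
move=> hD cD hX p; rewrite -[RHS]addr0.
by apply: (bracket_gen Dt_derivation hD derivation0 Dt_const cD) => // i; rewrite hX addr0.
Qed.

Lemma Dt_De p : Dt (De p) = De (Dt p).
Proof.
by apply: (Dt_comm De_derivation De_const); elim/ord5_ind;
  rewrite !varE ?(der0 De_derivation) ?(der0 Dt_derivation) ?(der1 De_derivation) ?varE.
Qed.

Lemma Dt_Df p : Dt (Df p) = Df (Dt p).
Proof.
by apply: (Dt_comm Df_derivation Df_const); elim/ord5_ind;
  rewrite !varE ?(der0 Df_derivation) ?(der0 Dt_derivation) ?(der1 Df_derivation) ?varE.
Qed.

Lemma Dt_Dh p : Dt (Dh p) = Dh (Dt p).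
Proof.
by apply: (Dt_comm Dh_derivation Dh_const); elim/ord5_ind;
  rewrite !varE ?(derN Dt_derivation) ?(der0 Dh_derivation) ?(der0 Dt_derivation)
    ?(der1 Dh_derivation) ?varE ?oppr0.
Qed.

(** Only a, b, c, d are integrated out; t survives as the variable of the resulting polynomial. *)
Definition haar_monomial (m : 'X_{1..5}) : {poly k} :=
  haar k (m va) (m vb) (m vc) (m vd) *: 'X^(m vt).

Definition integral : {linear B -> {poly k}} := mextend haar_monomial.

Lemma integral_Xderiv i j m : integral ('X_i * 'X_[m]^`M(j)) =
  (m j)%:R *: haar_monomial (U_(i) + (m - U_(j)))%MM.
Proof. by rewrite mderivX -scalerAr -mpolyXD linearZ /= mextendX. Qed.

Lemma integral_der0 D : derivation D -> (forall c, D c%:MP = 0) ->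
  (forall m, integral (D 'X_[m]) = 0) -> forall p, integral (D p) = 0.
Proof.
move=> hD cD h; elim/mpolyind=> [|c m p _ _ IH]; first by rewrite (der0 hD) linear0.
by rewrite (derD hD) -mul_mpolyC (derM hD) cD mul0r add0r mul_mpolyC linearP h IH scaler0 addr0.
Qed.

Lemma integral_De p : integral (De p) = 0.
Proof.
apply: (integral_der0 De_derivation De_const) => {p} m.
rewrite /De linearD /= -!/integral !integral_Xderiv /haar_monomial !(mnmDE, mnmBE, mnm1E) /=.
rewrite !add0n !add1n !subn0 !subn1 !scalerA -scalerDl.
by rewrite haar_e scale0r.
Qed.

Lemma integral_Df p : integral (Df p) = 0.
Proof.
apply: (integral_der0 Df_derivation Df_const) => {p} m.
rewrite /Df linearD /= -!/integral !integral_Xderiv /haar_monomial !(mnmDE, mnmBE, mnm1E) /=.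
rewrite !add0n !add1n !subn0 !subn1 !scalerA -scalerDl.
by rewrite haar_f scale0r.
Qed.

Lemma integral_Dh p : integral (Dh p) = 0.
Proof.
have e : Dh p = De (Df p) - Df (De p) by rewrite De_Df addrC addKr.
by rewrite e linearB integral_De integral_Df subrr.
Qed.

Lemma integral_Dt p : integral (Dt p) = (integral p)^`().
Proof.
elim/mpolyind: p => [|c m p _ _ IH]; first by rewrite (der0 Dt_derivation) linear0 deriv0.
rewrite (derD Dt_derivation) /Dt mderivZ !linearP /=; congr (c *: _ + _); last exact: IH.
rewrite mderivX linearZ /= !mextendX /haar_monomial !(mnmBE, mnm1E) /= !subn0 subn1 derivZ derivXn.
by rewrite scalerA mulrC -scalerA scaler_nat.
Qed.

(** By [haar_det]; the integral thus descends to functions on SL_2 x A^1. *)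
Lemma integral_delta p : integral (delta * p) = 0.
Proof.
elim/mpolyind: p => [|c m p _ _ IH]; first by rewrite mulr0 linear0.
rewrite mulrDr -scalerAr linearP IH addr0 /= /delta.
rewrite 2!mulrBl mul1r -!mpolyXD !linearB /= !mextendX /haar_monomial !(mnmDE, mnm1E) /=.
rewrite !(add0n, addn0, add1n) -!scalerBr -!scalerBl haar_det // subrr.
by rewrite scale0r scaler0.
Qed.

Lemma integral_Xt p : integral ('X_vt * p) = 'X * integral p.
Proof.
elim/mpolyind: p => [|c m p _ _ IH]; first by rewrite mulr0 linear0 mulr0.
rewrite mulrDr -scalerAr !linearP IH mulrDr -scalerAr; congr (_ *: _ + _).
rewrite -mpolyXD /= !mextendX /haar_monomial !(mnmDE, mnm1E) /= !add0n add1n.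
by rewrite exprS scalerAr.
Qed.

Lemma integral_one : integral 1 = 1.
Proof.
rewrite -mpolyX0 /= mextendX /haar_monomial !mnm0E /haar /= !fact0 !mulr1 divr1.
by rewrite scale1r.
Qed.

Definition at_time (s : k) : {rmorphism B -> B} :=
  msubst (fun i => if i == vt then s%:MP else 'X_i).

Lemma at_timeP s p : exists r, p = at_time s p + ('X_vt - s%:MP) * r.
Proof.
elim/mpoly_gen_ind: p => [c|i|p q [r ep] [r' eq]|p q [r ep] [r' eq]].
- by exists 0; rewrite mulr0 addr0 /= mmapC.
- rewrite msubstX; case: eqP => [->|_]; [exists 1 | exists 0]; ring.
- by exists (r + r'); rewrite rmorphD {1}ep {1}eq; ring.
- exists (r * at_time s q + at_time s p * r' + ('X_vt - s%:MP) * r * r').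
  by rewrite rmorphM {1}ep {1}eq; ring.
Qed.

(** [p] and its specialization differ by a multiple of t - s, and the integral is k[t]-linear. *)
Lemma integral_at_time s p : (integral p).[s] = (integral (at_time s p)).[s].
Proof.
have [r {1}->] := at_timeP s p; rewrite linearD mulrBl linearB integral_Xt mul_mpolyC linearZ /=.
by rewrite !(hornerD, hornerN, hornerM, hornerX, hornerZ) subrr addr0.
Qed.

Lemma at_time_comm s D : derivation D -> (forall c, D c%:MP = 0) ->
  (forall i, at_time s (D 'X_i) = D (at_time s 'X_i)) ->
  forall p, at_time s (D p) = D (at_time s p).
Proof.
move=> hD cD hX; elim/mpoly_gen_ind=> [c|//|p q ep eq|p q ep eq].
- by rewrite cD rmorph0 /= mmapC cD.
- by rewrite (derD hD) !rmorphD (derD hD) ep eq.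
- by rewrite (derM hD) rmorphD !rmorphM (derM hD) ep eq.
Qed.

Lemma at_time_De s p : at_time s (De p) = De (at_time s p).
Proof.
by apply: (at_time_comm De_derivation De_const); elim/ord5_ind;
  rewrite !varE ?rmorph0 !msubstX /= ?De_const ?varE.
Qed.

Lemma at_time_Df s p : at_time s (Df p) = Df (at_time s p).
Proof.
by apply: (at_time_comm Df_derivation Df_const); elim/ord5_ind;
  rewrite !varE ?rmorph0 !msubstX /= ?Df_const ?varE.
Qed.

Lemma at_time_Dh s p : at_time s (Dh p) = Dh (at_time s p).
Proof.
by apply: (at_time_comm Dh_derivation Dh_const); elim/ord5_ind;
  rewrite !varE ?rmorph0 ?rmorphN !msubstX /= ?Dh_const ?varE.
Qed.

End Functional.

(** * SL_2 has no polynomial contraction *)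

Section Ideal.
Variable k : closedFieldType.
Local Notation B := {mpoly k[5]}.
Implicit Types p q r : B.

Definition zero_at (j : 'I_5) : {rmorphism B -> B} :=
  msubst (fun i => if i == j then 0 else 'X_i).

Lemma zero_atP j p : exists r, p = zero_at j p + 'X_j * r.
Proof.
elim/mpoly_gen_ind: p => [c|i|p q [r ep] [r' eq]|p q [r ep] [r' eq]].
- by exists 0; rewrite mulr0 addr0 /= mmapC.
- rewrite msubstX; case: eqP => [->|_]; [exists 1 | exists 0]; ring.
- by exists (r + r'); rewrite rmorphD {1}ep {1}eq; ring.
- exists (r * zero_at j q + zero_at j p * r' + 'X_j * r * r').
  by rewrite rmorphM {1}ep {1}eq; ring.
Qed.

Lemma ev_zero_at j p (x y : 'rV[k]_5) : (forall i, i != j -> x 0 i = y 0 i) ->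
  ev (zero_at j p) x = ev (zero_at j p) y.
Proof.
move=> h; rewrite !ev_msubst; congr ev; apply/rowP=> i; rewrite !mxE.
by case: eqP => [_|/eqP/h]; rewrite ?ev0 // !evX.
Qed.

(** Modulo [delta], ad = 1 + bc, so d can be eliminated after multiplication by a power of a. *)
Lemma eliminate_d p : exists N q r, 'X_va ^+ N * p = zero_at vd q + delta k * r.
Proof.
elim/mpoly_gen_ind: p => [c|i|p1 p2 [N1 [q1 [r1 e1]]] [N2 [q2 [r2 e2]]]|
                          p1 p2 [N1 [q1 [r1 e1]]] [N2 [q2 [r2 e2]]]].
- by exists 0, c%:MP, 0; rewrite mul1r mulr0 addr0 /= mmapC.
- have [->|ne] := eqVneq i vd; last first.
    by exists 0, 'X_i, 0; rewrite mul1r mulr0 addr0 msubstX (negPf ne).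
  exists 1, (1 + 'X_vb * 'X_vc), 1.
  by rewrite rmorphD rmorphM rmorph1 !msubstX /= /delta; ring.
- exists (N1 + N2), ('X_va ^+ N2 * q1 + 'X_va ^+ N1 * q2), ('X_va ^+ N2 * r1 + 'X_va ^+ N1 * r2).
  rewrite rmorphD !rmorphM !rmorphXn !msubstX /=.
  transitivity ('X_va ^+ N2 * ('X_va ^+ N1 * p1) + 'X_va ^+ N1 * ('X_va ^+ N2 * p2)).
    by rewrite exprD; ring.
  by rewrite e1 e2; ring.
- exists (N1 + N2), (q1 * q2), (zero_at vd q1 * r2 + r1 * zero_at vd q2 + delta k * r1 * r2).
  transitivity (('X_va ^+ N1 * p1) * ('X_va ^+ N2 * p2)).
    by rewrite exprD; ring.
  by rewrite e1 e2 rmorphM; ring.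
Qed.

(** At a = 0 [delta] becomes - bc - 1, which is nonzero, so each factor a must divide [r]. *)
Lemma delta_cancel N p r : 'X_va ^+ N * p = delta k * r -> exists r', p = delta k * r'.
Proof.
elim: N r => [|N IH] r; first by rewrite mul1r => ->; exists r.
move=> e; have a0 : 'X_va != 0 :> B.
  by apply/eqP => /(congr1 (fun p => ev p (const_mx 1)))/eqP; rewrite evX ev0 mxE oner_eq0.
have d0 : zero_at va (delta k) != 0.
  apply/eqP => /(congr1 (fun p => ev p 0))/eqP.
  rewrite !rmorphB !rmorphM rmorph1 !msubstX /= !evE !mxE !(mul0r, subr0, sub0r).
  by rewrite oppr_eq0 oner_eq0.
have [r' er] := zero_atP va r; apply: (IH r'); apply: (mulfI a0).
suff z : zero_at va r = 0 by rewrite mulrA -exprS e er z add0r; ring.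
apply: (mulfI d0); rewrite mulr0 -rmorphM -e exprS rmorphM rmorphM msubstX /=.
by rewrite !mul0r.
Qed.

(** The Nullstellensatz for this hypersurface, by hand: once d is eliminated, the remainder vanishes
    wherever a is nonzero, hence it is 0, and the power of a cancels. *)
Lemma delta_ideal p :
  (forall x : 'rV[k]_5, x 0 va * x 0 vd - x 0 vb * x 0 vc = 1 -> ev p x = 0) ->
  exists r, p = delta k * r.
Proof.
move=> h; have [N [q [r e]]] := eliminate_d p.
apply: (@delta_cancel N p r); rewrite e -[RHS]add0r; congr (_ + _).
have /eqP : 'X_va * zero_at vd q = 0.
  apply: ev_eq0 => x; rewrite evM evX.
  have [->|xa] := eqVneq (x 0 va) 0; first by rewrite mul0r.
  (* The point with the same a, b, c, t and with d solved from the determinant. *)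
  pose y : 'rV[k]_5 := \row_i (if i == vd then (1 + x 0 vb * x 0 vc) / x 0 va else x 0 i).
  have ydet : y 0 va * y 0 vd - y 0 vb * y 0 vc = 1.
    by rewrite !mxE /= mulrC divfK // addrK.
  rewrite (@ev_zero_at vd q x y); last by move=> i ne; rewrite mxE (negPf ne).
  have := congr1 (fun p => ev p y) e; rewrite evM (h y ydet) mulr0 evD evM.
  have -> : ev (delta k) y = 0 by rewrite !evE ydet subrr.
  by rewrite mul0r addr0 => <-; rewrite mulr0.
rewrite mulf_eq0 => /orP[/eqP a0|/eqP //].
have := congr1 (fun p => ev p (const_mx 1)) a0; rewrite evX ev0 mxE => /eqP.
by rewrite oner_eq0.
Qed.

Definition congr_delta p q := exists r, p = q + delta k * r.

Lemma congr_deltaD p q p' q' :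
  congr_delta p q -> congr_delta p' q' -> congr_delta (p + p') (q + q').
Proof. by move=> [r ->] [r' ->]; exists (r + r'); ring. Qed.

Lemma congr_deltaM p q p' q' :
  congr_delta p q -> congr_delta p' q' -> congr_delta (p * p') (q * q').
Proof. by move=> [r ->] [r' ->]; exists (q * r' + r * q' + delta k * r * r'); ring. Qed.

Lemma congr_deltaB p q p' q' :
  congr_delta p q -> congr_delta p' q' -> congr_delta (p - p') (q - q').
Proof. by move=> [r ->] [r' ->]; exists (r - r'); ring. Qed.

Lemma congr_delta_trans p q r : congr_delta p q -> congr_delta q r -> congr_delta p r.
Proof. by move=> [s ->] [s' ->]; exists (s + s'); ring. Qed.

Lemma congr_delta_der D p q : derivation D -> D (delta k) = 0 ->
  congr_delta p q -> congr_delta (D p) (D q).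
Proof.
by move=> hD d0 [r ->]; exists (D r); rewrite (derD hD) (derM hD) d0; ring.
Qed.

Lemma der_delta0 D : derivation D ->
  D 'X_va * 'X_vd + 'X_va * D 'X_vd - (D 'X_vb * 'X_vc + 'X_vb * D 'X_vc) = 0 ->
  D (delta k) = 0.
Proof. by move=> hD <-; rewrite /delta !(derB hD) !(derM hD) (der1 hD) subr0. Qed.

Lemma De_delta : De (delta k) = 0.
Proof. by apply: (der_delta0 (@De_derivation k)); rewrite !varE; ring. Qed.
Lemma Df_delta : Df (delta k) = 0.
Proof. by apply: (der_delta0 (@Df_derivation k)); rewrite !varE; ring. Qed.
Lemma Dh_delta : Dh (delta k) = 0.
Proof. by apply: (der_delta0 (@Dh_derivation k)); rewrite !varE; ring. Qed.

Lemma congr_det3 (x1 x2 x3 y1 y2 y3 z1 z2 z3 x1' x2' x3' y1' y2' y3' z1' z2' z3' : B) :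
  congr_delta x1 x1' -> congr_delta x2 x2' -> congr_delta x3 x3' ->
  congr_delta y1 y1' -> congr_delta y2 y2' -> congr_delta y3 y3' ->
  congr_delta z1 z1' -> congr_delta z2 z2' -> congr_delta z3 z3' ->
  congr_delta (det3 x1 x2 x3 y1 y2 y3 z1 z2 z3) (det3 x1' x2' x3' y1' y2' y3' z1' z2' z3').
Proof.
by move=> *; rewrite /det3; do ?[apply: congr_deltaB | apply: congr_deltaD | apply: congr_deltaM].
Qed.

(** For the identity map of SL_2 the form is the invariant volume itself, which is 1 on the frame e,
    f, h. *)
Lemma mc_volume_universal (a b c d : B) :
  congr_delta a 'X_va -> congr_delta b 'X_vb -> congr_delta c 'X_vc -> congr_delta d 'X_vd ->
  congr_delta (mc_volume a b c d (@De k) (@Df k) (@Dh k)) 1.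
Proof.
move=> ha hb hc hd.
have eD := fun p q h => congr_delta_der (p := p) (q := q) (@De_derivation k) De_delta h.
have fD := fun p q h => congr_delta_der (p := p) (q := q) (@Df_derivation k) Df_delta h.
have hD := fun p q h => congr_delta_der (p := p) (q := q) (@Dh_derivation k) Dh_delta h.
apply: congr_delta_trans (congr_det3 _ _ _ _ _ _ _ _ _) _; rewrite /mc1 /mc2 /mc3;
  try (by apply: congr_deltaB; apply: congr_deltaM; try eassumption;
    first [apply: eD | apply: fD | apply: hD]; eassumption).
(* With u = ad - bc the volume is u^3, and u^3 - 1 = (u - 1)(u^2 + u + 1). *)
rewrite !varE; exists (('X_va * 'X_vd - 'X_vb * 'X_vc) ^+ 2 + ('X_va * 'X_vd - 'X_vb * 'X_vc) + 1).
by rewrite /det3 /delta; ring.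
Qed.

End Ideal.

Lemma rmorph_mc_volume (R : comNzRingType) (s : {rmorphism R -> R}) (e f h : R -> R) a b c d :
  (forall p, s (e p) = e (s p)) -> (forall p, s (f p) = f (s p)) ->
  (forall p, s (h p) = h (s p)) ->
  s (mc_volume a b c d e f h) = mc_volume (s a) (s b) (s c) (s d) e f h.
Proof.
move=> se sf sh; have sD D : (forall p, s (D p) = D (s p)) -> [/\ s (mc1 a b c d D) =
    mc1 (s a) (s b) (s c) (s d) D, s (mc2 b d D) = mc2 (s b) (s d) D
    & s (mc3 a c D) = mc3 (s a) (s c) D].
  by move=> hD; split; rewrite rmorphB !rmorphM !hD.
have [e1 e2 e3] := sD e se; have [f1 f2 f3] := sD f sf; have [h1 h2 h3] := sD h sh.
have sdet x1 x2 x3 y1 y2 y3 z1 z2 z3 : s (det3 x1 x2 x3 y1 y2 y3 z1 z2 z3) =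
    det3 (s x1) (s x2) (s x3) (s y1) (s y2) (s y3) (s z1) (s z2) (s z3).
  by rewrite /det3 rmorphD rmorphB !rmorphM !rmorphB !rmorphM.
by rewrite /mc_volume sdet e1 e2 e3 f1 f2 f3 h1 h2 h3.
Qed.

Lemma mc_volume_const (k : closedFieldType) (a b c d : k) D2 D3 :
  mc_volume a%:MP b%:MP c%:MP d%:MP (@De k) D2 D3 = 0.
Proof.
by rewrite /mc_volume /mc1 /mc2 /mc3 !De_const !mulr0 subrr /det3 !mul0r subrr addr0.
Qed.

(* A contraction t |-> psi (t * phi g) of SL_2 to a point would make the invariant
   volume form, whose integral is 1, exact. *)
Lemma no_contraction (k : closedFieldType) (hk : [pchar k] =i pred0) n
    (psia psib psic psid : {mpoly k[n]}) (phi : 'I_n -> {mpoly k[5]}) :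
  psia * psid - psib * psic = 1 ->
  (forall x : 'rV[k]_5, x 0 va * x 0 vd - x 0 vb * x 0 vc = 1 ->
    let y := \row_j ev (phi j) x in
    [/\ ev psia y = x 0 va, ev psib y = x 0 vb, ev psic y = x 0 vc & ev psid y = x 0 vd]) ->
  False.
Proof.
(* [M] is the pullback of functions along (g, t) |-> t phi(g). *)
move=> det1 inv; pose M := msubst (fun j => 'X_vt * phi j).
have Mdet : M psia * M psid - M psib * M psic = 1 by rewrite -!rmorphM -rmorphB det1 rmorph1.
pose w := mc_volume (M psia) (M psib) (M psic) (M psid) (@De k) (@Df k) (@Dh k).
have dw : integral k (Dt w) = 0.
  rewrite (mc_volume_homotopy Mdet (@De_derivation k) (@Df_derivation k) (@Dh_derivation k)
    (@Dt_derivation k) (@De_Df k) (@Dh_De k) (@Dh_Df k) (@Dt_De k) (@Dt_Df k) (@Dt_Dh k)).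
  have iD p q : integral k (p + q) = integral k p + integral k q by exact: linearD.
  by rewrite 2!iD integral_De integral_Df integral_Dh !addr0.
have cw : (integral k w).[0] = (integral k w).[1].
  (* The derivative is zero, and in characteristic zero this kills every coefficient of positive
     degree. *)
  suff /size1_polyC -> : (size (integral k w) <= 1)%N by rewrite !hornerC.
  apply/leq_sizeP => j; case: j => // j _.
  move: dw; rewrite integral_Dt => /(congr1 (fun q : {poly k} => q`_j)).
  rewrite coef_deriv coef0 -mulr_natr => /eqP; rewrite mulf_eq0.
  by rewrite (negPf (natS_neq0 hk j)) orbF => /eqP.
have atw s : at_time s w = mc_volume (at_time s (M psia)) (at_time s (M psib))
    (at_time s (M psic)) (at_time s (M psid)) (@De k) (@Df k) (@Dh k).
  exact: rmorph_mc_volume (at_time_De s) (at_time_Df s) (at_time_Dh s).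
have evM s p x : ev (at_time s (M p)) x = ev p (\row_j (s * ev (at_time s (phi j)) x)).
  rewrite !ev_msubst; congr ev; apply/rowP=> j; rewrite !mxE evM evX mxE eqxx evC.
  by rewrite ev_msubst.
have M0 p : at_time 0 (M p) = (ev p 0)%:MP.
  apply/eqP; rewrite -subr_eq0; apply/eqP/ev_eq0 => x; rewrite evB evC evM.
  rewrite (_ : \row_j _ = 0) ?subrr //; by apply/rowP=> j; rewrite !mxE mul0r.
have w0 : at_time 0 w = 0 by rewrite atw !M0 mc_volume_const.
have w1 : congr_delta (at_time 1 w) 1.
  have main p i : (forall x : 'rV[k]_5, x 0 va * x 0 vd - x 0 vb * x 0 vc = 1 ->
      ev p (\row_j ev (phi j) x) = x 0 i) -> i != vt -> congr_delta (at_time 1 (M p)) 'X_i.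
    move=> h ne; have [|r e] := @delta_ideal k (at_time 1 (M p) - 'X_i).
      move=> x hx; rewrite evB evX evM.
      (* [phi] may involve t, and [at_time 1] reads it at t = 1; the determinant condition does not
         see this coordinate. *)
      pose y : 'rV[k]_5 := \row_i (if i == vt then 1 else x 0 i).
      have -> : x 0 i = y 0 i by rewrite mxE (negPf ne).
      rewrite -h ?mxE //; apply/eqP; rewrite subr_eq0; apply/eqP; congr ev.
      apply/rowP=> j; rewrite !mxE mul1r ev_msubst; congr ev; apply/rowP=> l; rewrite !mxE.
      by case: eqP => _; rewrite ?evC ?evX.
    by exists r; rewrite -e; ring.
  rewrite atw; apply: mc_volume_universal; apply: main => // x /inv[] //.
have [r er] := w1.
have := cw; rewrite (integral_at_time 0) (integral_at_time 1) w0 er linear0 linearD.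
rewrite integral_one integral_delta // addr0 horner0 hornerC => /eqP.
by rewrite eq_sym oner_eq0.
Qed.

(** * Fractional maps and the group SL_2 *)

Section FractionMaps.
Variable k : closedFieldType.

(** Clearing denominators; the exponent is existential, so that exponents simply add up under sums
    and products. *)
Lemma fraction_homogenize n m (p : 'I_m -> {mpoly k[n]}) q (r : {mpoly k[m]}) :
  exists N s, forall x, ev q x != 0 ->
    ev r (\row_j (ev (p j) x / ev q x)) * ev q x ^+ N = ev s x.
Proof.
elim/mpoly_gen_ind: r => [c|i|r1 r2 [N1 [s1 e1]] [N2 [s2 e2]]|r1 r2 [N1 [s1 e1]] [N2 [s2 e2]]].
- by exists 0, c%:MP => x _; rewrite !evC mulr1.
- by exists 1, (p i) => x qx; rewrite evX mxE expr1 divfK.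
- exists (N1 + N2), (s1 * q ^+ N2 + s2 * q ^+ N1) => x qx.
  by rewrite !evE -e1 // -e2 // exprD; ring.
- exists (N1 + N2), (s1 * s2) => x qx.
  by rewrite !evE -e1 // -e2 // exprD; ring.
Qed.

Lemma fraction_regular_map n m (V : subset_of_space k n) (W : subset_of_space k m)
    (p : 'I_m -> {mpoly k[n]}) q phi :
  (forall x, V x -> ev q x != 0) ->
  (forall x, V x -> phi x = \row_j (ev (p j) x / ev q x)) ->
  (forall x, V x -> W (phi x)) ->
  regular_map V W phi.
Proof.
move=> qV phiE VW; split=> //.
- move=> U [S hS].
  pose S' s := exists2 r, S r & exists N, forall x, ev q x != 0 ->
    ev r (\row_j (ev (p j) x / ev q x)) * ev q x ^+ N = ev s x.
  exists (fun x => ~ forall s, S' s -> ev s x = 0).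
    by exists S' => x; split=> [/NNPP //|h]; apply.
  move=> x Vx; have qx := qV x Vx; split=> [Ux h|h].
    apply: (proj2 (hS _) _ Ux) => r Sr; have [N [s e]] := fraction_homogenize p q r.
    have : ev s x = 0 by apply: h; exists r => //; exists N.
    rewrite -e // -phiE // => /eqP; rewrite mulf_eq0 expf_eq0 (negPf qx) andbF orbF.
    by move/eqP.
  apply: NNPP => /(proj1 (hS _)) h'; apply: h => s [r Sr [N e]].
  by rewrite -e // -phiE // h' ?mul0r.
- move=> a f Va /(regular_atP _ (VW a Va))[p' [q' [q'a h]]].
  have [N [s es]] := fraction_homogenize p q p'.
  have [N' [s' es']] := fraction_homogenize p q q'.
  (* The crossed powers of [q] balance the exponents cleared from numerator and denominator. *)
  apply/(regular_atP _ Va); exists (s * q ^+ N'), (s' * q ^+ N).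
  have qa := qV a Va; rewrite evM evXn -es' // -phiE //.
  split=> [|x Vx]; first by rewrite !mulf_neq0 ?expf_neq0.
  have qx := qV x Vx; rewrite !evM !evXn -es // -es' // -phiE //.
  rewrite !mulf_eq0 !negb_or => /andP[/andP[q'x qN'] qN].
  by rewrite /= h //; [field; rewrite q'x qN qN' | exact: VW].
Qed.

Lemma irreducible_image n m (V : subset_of_space k n) (W : subset_of_space k m) phi :
  irreducible_set V -> regular_map V W phi ->
  (forall y, W y -> exists2 x, V x & phi x = y) -> irreducible_set W.
Proof.
move=> [[x0 Vx0] irr] [VW cont _] surj; split; first by exists (phi x0); apply: VW.
have pre Z : zariski_closed Z ->
    exists2 Z', zariski_closed Z' & forall x, V x -> (Z (phi x) <-> Z' x).
  case=> S hS; have oZ : zariski_open (fun y => ~ Z y).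
    by exists S => y; split=> [/NNPP/hS //|/hS Zy]; apply.
  have [U' oU' h] := cont _ oZ; exists (fun x => ~ U' x) => // x Vx.
  by split=> [Zx /(h x Vx)//|nU]; apply: NNPP => /(h x Vx).
move=> Z1 Z2 /pre[Z1' c1 e1] /pre[Z2' c2 e2] cov.
have [x Vx|h|h] := irr Z1' Z2' c1 c2.
- by case: (cov _ (VW x Vx)) => h; [left; apply/(e1 x Vx) | right; apply/(e2 x Vx)].
- by left=> y /surj[x Vx <-]; apply/(e1 x Vx)/h.
- by right=> y /surj[x Vx <-]; apply/(e2 x Vx)/h.
Qed.

Lemma basic_open_irreducible n (g : {mpoly k[n]}) : g != 0 ->
  irreducible_set (fun x => ev g x != 0).
Proof.
move=> g0; split.
  apply: NNPP => h; case/eqP: g0; apply: ev_eq0 => x; apply/eqP/negPn/negP => gx.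
  by apply: h; exists x.
move=> Z1 Z2 [S1 h1] [S2 h2] cov; apply: NNPP => /not_or_and[n1 n2].
have wit (Z : subset_of_space k n) S : (forall x, Z x <-> forall p, S p -> ev p x = 0) ->
    ~ (forall x, ev g x != 0 -> Z x) -> exists2 p, S p & p != 0.
  move=> hS nZ; apply: NNPP => h; apply: nZ => x _; apply/hS => p Sp.
  by apply/eqP/negPn/negP => px; apply: h; exists p => //; apply: contraNneq px => ->; rewrite ev0.
have {}n1 : exists2 p, S1 p & p * g != 0.
  by have [p Sp p0] := wit _ _ h1 n1; exists p; rewrite ?mulf_neq0.
have {}n2 : exists2 p, S2 p & p != 0 by exact: wit _ _ h2 n2.
have [p1 Sp1 p10] := n1; have [p2 Sp2 p20] := n2.
suff e : p1 * g * p2 = 0 by move/eqP: e; rewrite mulf_eq0 (negPf p10) (negPf p20).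
apply: ev_eq0 => x; rewrite !evM; have [->|gx] := eqVneq (ev g x) 0; first by rewrite mulr0 mul0r.
by case: (cov x gx) => [/h1/(_ _ Sp1)|/h2/(_ _ Sp2)] ->; rewrite ?mul0r ?mulr0.
Qed.

End FractionMaps.

Local Notation ja := (@Ordinal 4 0 isT).
Local Notation jb := (@Ordinal 4 1 isT).
Local Notation jc := (@Ordinal 4 2 isT).
Local Notation jd := (@Ordinal 4 3 isT).

Lemma ord4_ind (P : 'I_4 -> Prop) : P ja -> P jb -> P jc -> P jd -> forall i, P i.
Proof.
move=> Pa Pb Pc Pd [[|[|[|[|//]]]] h].
- by rewrite (_ : Ordinal h = ja) //; apply: val_inj.
- by rewrite (_ : Ordinal h = jb) //; apply: val_inj.
- by rewrite (_ : Ordinal h = jc) //; apply: val_inj.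
- by rewrite (_ : Ordinal h = jd) //; apply: val_inj.
Qed.

Lemma ord2_ind (P : 'I_2 -> Prop) : P ord0 -> P (lift ord0 ord0) -> forall i, P i.
Proof.
move=> P0 P1 [[|[|//]] h]; first by rewrite (_ : Ordinal h = ord0) //; apply: val_inj.
by rewrite (_ : Ordinal h = lift ord0 ord0) //; apply: val_inj.
Qed.

Section SpecialLinear.
Variable k : closedFieldType.

Definition row_of_seq n (s : seq k) : 'rV[k]_n := \row_i nth 0 s i.

(* The matrix (a, b; c, d) is the point (a, b, c, d) of A^4. *)
Definition SL2 : subset_of_space k 4 :=
  fun x => x 0 ja * x 0 jd - x 0 jb * x 0 jc = 1.

Definition hyperbola : subset_of_space k 2 :=
  fun y => y 0 ord0 * y 0 (lift ord0 ord0) = 1.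

Definition det2 : {mpoly k[4]} := 'X_ja * 'X_jd - 'X_jb * 'X_jc.

Lemma ev_det2 x : ev det2 x = x 0 ja * x 0 jd - x 0 jb * x 0 jc.
Proof. by rewrite !evE. Qed.

Lemma SL2_closed : zariski_closed SL2.
Proof.
exists (eq (det2 - 1)) => x; rewrite /SL2; split=> [e p <-|/(_ _ erefl)].
  by rewrite !evE e subrr.
by rewrite !evE => /eqP; rewrite subr_eq0 => /eqP.
Qed.

Lemma hyperbola_closed : zariski_closed hyperbola.
Proof.
exists (eq ('X_ord0 * 'X_(lift ord0 ord0) - 1)) => x.
rewrite /hyperbola; split=> [e p <-|/(_ _ erefl)].
  by rewrite !evE e subrr.
by rewrite !evE => /eqP; rewrite subr_eq0 => /eqP.
Qed.

Lemma det2_neq0 : det2 != 0.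
Proof.
apply/eqP => /(congr1 (fun p => ev p (row_of_seq 4 [:: 1; 0; 0; 1])))/eqP.
by rewrite !evE !mxE /= mulr1 mulr0 subr0 oner_eq0.
Qed.

Lemma SL2_irreducible : irreducible_set SL2.
Proof.
(* SL_2 is the image of GL_2 when the first column is divided by the determinant; the factors [det2]
   put all entries over one denominator. *)
pose p (i : 'I_4) := nth 0 [:: 'X_ja; 'X_jb * det2; 'X_jc; 'X_jd * det2] i.
apply: (irreducible_image (basic_open_irreducible det2_neq0)
  (phi := fun x => \row_j (ev (p j) x / ev det2 x))).
- apply: (@fraction_regular_map _ _ _ _ _ p det2) => // x dx.
  rewrite /SL2 !mxE /p /= ![ev (_ * det2) _]evM !evX.
  move: (ev_det2 x) dx; set u := ev det2 x => e dx.
  transitivity ((x 0 ja * x 0 jd - x 0 jb * x 0 jc) / u); first by field.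
  by rewrite -e divff.
- move=> y Sy; have dy : ev det2 y = 1 by rewrite !evE.
  exists y; first by rewrite dy oner_neq0.
  by apply/rowP; elim/ord4_ind; rewrite mxE dy divr1 /p /= ?evM ?dy ?mulr1 evX.
Qed.

Lemma X1_neq0 : ('X_ord0 : {mpoly k[1]}) != 0.
Proof.
apply/eqP => /(congr1 (fun p => ev p (const_mx 1)))/eqP.
by rewrite !evE mxE oner_eq0.
Qed.

Lemma isomorphic_irreducible n m (V : subset_of_space k n) (W : subset_of_space k m) :
  isomorphic W V -> irreducible_set V -> irreducible_set W.
Proof.
move=> [phi [psi [[WV _ _] psiR psiphi phipsi]]] irrV.
by apply: irreducible_image irrV psiR _ => y Wy; exists (phi y); [apply: WV | apply: psiphi].
Qed.

Lemma flattenable_basic_open n m (V : subset_of_space k n) (g : {mpoly k[m]}) : g != 0 ->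
  isomorphic V (fun x => ev g x != 0) -> flattenable V.
Proof.
move=> g0 iso; split; first exact: isomorphic_irreducible iso (basic_open_irreducible g0).
by exists m, (fun x => ev g x != 0); split=> //; apply: basic_open.
Qed.

Lemma hyperbola_flattenable : flattenable hyperbola.
Proof.
apply: (flattenable_basic_open X1_neq0).
(* Numerators of x |-> (x, 1/x) over the common denominator x. *)
pose p (i : 'I_2) : {mpoly k[1]} := nth 0 [:: 'X_ord0 * 'X_ord0; 1] i.
pose phi (y : 'rV[k]_2) : 'rV[k]_1 := \row__ (ev 'X_ord0 y / ev 1 y).
pose psi (x : 'rV[k]_1) : 'rV[k]_2 := \row_j (ev (p j) x / ev 'X_ord0 x).
have y0 y : hyperbola y -> y 0 ord0 != 0.
  by rewrite /hyperbola => e; apply: contra_eq_neq e => ->; rewrite mul0r eq_sym oner_neq0.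
exists phi, psi; split.
- apply: (@fraction_regular_map _ _ _ _ _ (fun=> 'X_ord0) 1) => // y Hy.
    by rewrite ev1 oner_neq0.
  by rewrite evX mxE ev1 divr1 evX y0.
- apply: (@fraction_regular_map _ _ _ _ _ p 'X_ord0) => // x x0.
  by rewrite /hyperbola !mxE /p /= evM ev1 evX mulfK ?mul1r ?divff //; move: x0; rewrite evX.
- move=> y Hy; apply/rowP; elim/ord2_ind;
    rewrite mxE /p /= ?(evM, ev1) !evX !mxE ev1 evX ?divr1 ?mul1r.
    by rewrite mulfK // y0.
  by apply: (mulfI (y0 _ Hy)); rewrite divff ?y0 //; symmetry; apply: Hy.
- move=> x; rewrite evX => x0; apply/rowP=> i; rewrite ord1 !mxE /p /= evX ev1 divr1 mxE /=.
  by rewrite evM evX mulfK.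
Qed.

Lemma product_flattenable : flattenable (product_set SL2 hyperbola).
Proof.
apply: (flattenable_basic_open det2_neq0).
pose v i : {mpoly k[4 + 2]} := 'X_(lshift 2 i).
pose t : {mpoly k[4 + 2]} := 'X_(rshift 4 ord0).
(* Scaling the first column by t makes the determinant t. The inverse [q] divides this column by det
   and returns (det, 1/det), all over the denominator det. *)
pose p (i : 'I_4) := nth 0 [:: v ja * t; v jb; v jc * t; v jd] i.
pose q (j : 'I_(4 + 2)) := match split j with
  | inl i => nth 0 [:: 'X_ja; 'X_jb * det2; 'X_jc; 'X_jd * det2] i
  | inr i => nth 0 [:: det2 * det2; 1] i
  end.
pose phi (z : 'rV[k]_(4 + 2)) := \row_j (ev (p j) z / ev 1 z).
pose psi (x : 'rV[k]_4) := \row_j (ev (q j) x / ev det2 x).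
have psiE x : psi x = row_mx
    (row_of_seq 4 [seq ev r x / ev det2 x | r <- [:: 'X_ja; 'X_jb * det2; 'X_jc; 'X_jd * det2]])
    (row_of_seq 2 [seq ev r x / ev det2 x | r <- [:: det2 * det2; 1]]).
  apply/rowP=> j; rewrite !mxE /q; case: split => i; rewrite mxE.
    by elim/ord4_ind: i.
  by elim/ord2_ind: i.
have phiE x : phi x = row_of_seq 4 [:: lsubmx x 0 ja * rsubmx x 0 ord0; lsubmx x 0 jb;
    lsubmx x 0 jc * rsubmx x 0 ord0; lsubmx x 0 jd].
  by apply/rowP; elim/ord4_ind; rewrite !mxE ev1 divr1 /p /= ?evM !evX.
have tn0 z : hyperbola (rsubmx z) -> rsubmx z 0 ord0 != 0.
  by rewrite /hyperbola => e; apply: contra_eq_neq e => ->; rewrite mul0r eq_sym oner_neq0.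
have detphi z : product_set SL2 hyperbola z -> ev det2 (phi z) = rsubmx z 0 ord0.
  case=> Sz _; rewrite ev_det2 phiE ![row_of_seq _ _ _ _]mxE /=.
  rewrite -[RHS]mul1r -[in RHS]Sz; ring.
exists phi, psi; split.
- apply: (@fraction_regular_map _ _ _ _ _ p 1) => // z Pz; first by rewrite ev1 oner_neq0.
  by rewrite detphi // tn0 //; case: Pz.
- apply: (@fraction_regular_map _ _ _ _ _ q det2) => // x dx.
  rewrite psiE /product_set row_mxKl row_mxKr /SL2 /hyperbola !mxE /= !(evM, evX, ev1).
  move: (ev_det2 x) dx; set u := ev det2 x => e dx; split; last by field.
  transitivity ((x 0 ja * x 0 jd - x 0 jb * x 0 jc) / u); first by field.
  by rewrite -e divff.
- move=> z Pz; have [Sz Hz] := Pz; have t0 := tn0 _ _ Hz.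
  rewrite psiE -[RHS]hsubmxK /= !(evM, evX, ev1) detphi // phiE.
  move: (lsubmx z) (rsubmx z) Sz Hz t0 => x y Sz Hz t0; congr row_mx.
    by apply/rowP; elim/ord4_ind; rewrite !mxE /=; field.
  apply/rowP; elim/ord2_ind; rewrite mxE /=; first by rewrite mulfK.
  by apply: (mulfI t0); rewrite mul1r divff // Hz.
- move=> x dx; rewrite phiE psiE row_mxKl row_mxKr; apply/rowP.
  by elim/ord4_ind; rewrite !mxE /= !(evM, evX, ev1); field.
Qed.

Definition vec4 (T : Type) (a b c d : T) (i : 'I_4) := nth a [:: a; b; c; d] i.

(* The product E(s) F(u) E(t) F(v) of elementary matrices. *)
Definition elementary_product (i : 'I_4) : {mpoly k[4]} :=
  let s := 'X_ja in let u := 'X_jb in let t := 'X_jc in let v := 'X_jd in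
  vec4 ((1 + s * u) * (1 + t * v) + s * v) ((1 + s * u) * t + s)
       (u * (1 + t * v) + v) (u * t + 1) i.

Definition mu (z : 'rV[k]_4) : 'rV[k]_4 := \row_j ev (elementary_product j) z.

Lemma mu_SL2 z : SL2 (mu z).
Proof. by rewrite /SL2 !mxE /elementary_product /vec4 /= !evE; ring. Qed.

Lemma mu_regular : regular_map (fun=> True) SL2 mu.
Proof.
apply: (@fraction_regular_map _ _ _ _ _ elementary_product 1) => [x _|x _|x _].
- by rewrite ev1 oner_neq0.
- by apply/rowP=> j; rewrite !mxE ev1 divr1.
- exact: mu_SL2.
Qed.

(** The upper right entry of E(-s) g. Where it is nonzero, E(-s) g = F(u) E(t) F(v) with t equal to
    this entry, so [mu] has a rational section for each [s]. *)
Definition section_den (s : k) : {mpoly k[4]} := 'X_jb - s%:MP * 'X_jd.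

(** Numerators of s, u, t, v over the common denominator [section_den s]. *)
Definition section_num (s : k) : 'I_4 -> {mpoly k[4]} :=
  let q := section_den s in
  vec4 (s%:MP * q) ('X_jd - 1) (q ^+ 2) ('X_ja - s%:MP * 'X_jc - 1).

Lemma elementary_section (s a b c d : k) : a * d - b * c = 1 -> b - s * d != 0 ->
  let q := b - s * d in let u := (d - 1) / q in let v := (a - s * c - 1) / q in
  [/\ (1 + s * u) * (1 + q * v) + s * v = a, (1 + s * u) * q + s = b,
      u * (1 + q * v) + v = c & u * q + 1 = d].
Proof.
move=> e q0 q u v.
(* The equations for b and d hold by the choice of [q] and [u]; those for a and c reduce to this
   one, where the determinant enters. *)
have key : ((d - 1) * (a - s * c) + (a - s * c - 1)) / q = c.
  apply: (mulIf q0); rewrite divfK //; transitivity (c * q + (a * d - b * c - 1)).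
    by rewrite /q; ring.
  by rewrite e subrr addr0.
split; rewrite /u /v.
- transitivity (a - s * c + s * (((d - 1) * (a - s * c) + (a - s * c - 1)) / q)).
    by field.
  by rewrite key; ring.
- by transitivity (q + s * d); [field | rewrite /q subrK].
- by rewrite -[RHS]key; field.
- by rewrite divfK // subrK.
Qed.

Lemma mu_section s x : SL2 x -> ev (section_den s) x != 0 ->
  mu (\row_j (ev (section_num s j) x / ev (section_den s) x)) = x.
Proof.
move=> Sx; have qE : ev (section_den s) x = x 0 jb - s * x 0 jd by rewrite !evE.
rewrite qE => q0; have := elementary_section Sx q0.
set z : 'rV_4 := \row_j _ => /=.
have za : z 0 ja = s by rewrite mxE /section_num /vec4 /= evM evC qE mulfK.
have zb : z 0 jb = (x 0 jd - 1) / (x 0 jb - s * x 0 jd).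
  by rewrite mxE /section_num /vec4 /= evB evX ev1.
have zc : z 0 jc = x 0 jb - s * x 0 jd.
  by rewrite mxE /section_num /vec4 /= evXn qE expr2 mulfK.
have zd : z 0 jd = (x 0 ja - s * x 0 jc - 1) / (x 0 jb - s * x 0 jd).
  by rewrite mxE /section_num /vec4 /= !(evB, evM, evX, evC, ev1).
rewrite -{}zb -{}zd -{}zc => -[ea eb ec ed].
apply/rowP; elim/ord4_ind; rewrite mxE /elementary_product /vec4 /= !(evD, evM, evX, ev1) ?za.
- exact: ea.
- exact: eb.
- exact: ec.
- exact: ed.
Qed.

End SpecialLinear.

(** * SL_2 is not flattenable *)

(** Each binomial term contains u^m or v^n. With u + v = 1 this glues local expressions with
    denominators u^m and v^n. *)
Lemma exp_add_split (R : comNzRingType) (u v : R) m n :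
  exists a b, (u + v) ^+ (m + n) = u ^+ m * a + v ^+ n * b.
Proof.
elim: m n => [|m IHm] n; first by exists ((u + v) ^+ n), 0; rewrite mul1r mulr0 addr0.
elim: n => [|n [a [b e]]]; first by exists 0, ((u + v) ^+ (m.+1 + 0)); rewrite mul1r mulr0 add0r.
have [a' [b' e']] := IHm n.+1.
exists (a' + v * a), (u * b' + b).
by rewrite addSn exprS mulrDl {1}e' addnS -addSn e !exprS; ring.
Qed.

Section NotFlattenable.
Variable k : closedFieldType.
Hypothesis hk : [pchar k] =i pred0.
Local Notation SL2k := (@SL2 k).

(** Two charts cover SL_2: b = 0 and b = d together would make the second column zero. *)
Lemma section_den_neq0 (x : 'rV[k]_4) : SL2k x ->
  ev (section_den 0) x != 0 \/ ev (section_den 1) x != 0.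
Proof.
rewrite /SL2 /section_den !evE => Sx; rewrite mul0r mul1r subr0.
have [b0|] := eqVneq (x 0 jb) 0; last by left.
right; rewrite b0 sub0r oppr_eq0; apply: contra_eq_neq Sx => ->.
by rewrite b0 mulr0 mul0r subrr eq_sym oner_neq0.
Qed.

Lemma mu_surjective (x : 'rV[k]_4) : SL2k x -> exists z, mu z = x.
Proof.
by move=> Sx; case: (section_den_neq0 Sx) => /(mu_section Sx) e;
  rewrite -{}e; eexists.
Qed.

Lemma regular_mu f : (forall x, SL2k x -> regular_at SL2k f x) ->
  exists p, forall z : 'rV[k]_4, f (mu z) = ev p z.
Proof.
move=> reg; apply: (@regular_polynomial k 4 (f \o @mu k)) => z.
by have [_ _] := mu_regular k; apply=> //; apply: reg; apply: mu_SL2.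
Qed.

(** [f] composed with [mu] is a polynomial; the sections of [mu] turn it into fractions on the two
    charts, which a partition of unity glues. *)
Lemma regular_SL2 f : (forall x, SL2k x -> regular_at SL2k f x) ->
  exists p, forall x, SL2k x -> f x = ev p x.
Proof.
move=> /regular_mu[p hp].
have loc s : exists N r, forall x, SL2k x -> f x * ev (section_den s) x ^+ N = ev r x.
  have [N [r hr]] := fraction_homogenize (section_num s) (section_den s) p.
  (* The extra factor makes both sides vanish off the chart, so the identity holds on all of
     SL_2. *)
  exists N.+1, (r * section_den s) => x Sx; rewrite evM exprSr mulrA.
  have [->|q0] := eqVneq (ev (section_den s) x) 0; first by rewrite !mulr0.
  by rewrite -hr // -hp mu_section.
have [m [r0 h0]] := loc 0; have [n [r1 h1]] := loc 1.
(* b(a - c) - (b - d)a = ad - bc, which is 1 on SL_2. *)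
pose u := section_den (0 : k) * ('X_ja - 'X_jc); pose v := section_den (1 : k) * - 'X_ja.
have [a [b e]] := exp_add_split u v m n.
exists (r0 * ('X_ja - 'X_jc) ^+ m * a + r1 * (- 'X_ja) ^+ n * b) => x Sx.
have uv1 : ev (u + v) x = 1.
  by rewrite /u /v /section_den !evE -[RHS]Sx; ring.
rewrite -[LHS]mulr1 -(expr1n _ (m + n)) -uv1 -evXn e /u /v !exprMn !evD !evM !evXn.
by rewrite -h0 // -h1 //; ring.
Qed.

(** Pulled back along the surjection [mu], [p] has no zero on A^4, hence is constant. *)
Lemma SL2_nonvanishing_const p : (forall x, SL2k x -> ev p x != 0) ->
  forall x y, SL2k x -> SL2k y -> ev p x = ev p y.
Proof.
move=> h x y /mu_surjective[z <-] /mu_surjective[w <-]; rewrite -!ev_msubst.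
by apply: ev_nonvanishing => t; rewrite ev_msubst; apply: h; apply: mu_SL2.
Qed.

Lemma coordinate_regular n (V : subset_of_space k n) i a : regular_at V (fun x => x 0 i) a.
Proof.
exists (fun=> True), 'X_i, 1; split=> //; first exact: zariski_openT.
by move=> x _ _; rewrite ev1 evX divr1 oner_neq0.
Qed.

Lemma SL2_not_flattenable : ~ flattenable SL2k.
Proof.
move=> [[[x0 Sx0] _] [n [U [oU [phi [psi [[SU _ phiR] [US _ psiR] psiphi phipsi]]]]]]].
have neU : exists y, U y by exists (phi x0); apply: SU.
have [F hF] : exists F, forall j : 'I_n, forall x, SL2k x -> phi x 0 j = ev (F j) x.
  apply: (@fin_all_exists _ _ (fun j p => forall x, SL2k x -> phi x 0 j = ev p x)) => j.
  apply: (@regular_SL2 (fun x => phi x 0 j)) => x Sx.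
  by apply: (phiR x (fun y => y 0 j)) => //; apply: coordinate_regular.
have phiE x : SL2k x -> phi x = \row_j ev (F j) x.
  by move=> Sx; apply/rowP=> j; rewrite mxE hF.
have [G hG] : exists G, forall i : 'I_4, forall y, U y -> psi y 0 i = ev (G i) y.
  apply: (@fin_all_exists _ _ (fun i p => forall y, U y -> psi y 0 i = ev p y)) => i.
  have [|p [q h]] := @regular_fraction k n U (fun y => psi y 0 i) oU neU.
    by move=> y Uy; apply: (psiR y (fun x => x 0 i)) => //; apply: coordinate_regular.
  (* [q] composed with [phi] has no zero on SL_2, so [q] is constant on [U], with its value at
     [phi x0]. *)
  exists (p * (ev q (phi x0))^-1%:MP) => y Uy; rewrite evM evC; have [_ ->] := h y Uy.
  congr (_ / _); rewrite -[in LHS](phipsi y Uy) !phiE //; last exact: US.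
  rewrite -!ev_msubst; apply: SL2_nonvanishing_const => // [x Sx|]; last exact: US.
  by rewrite ev_msubst -phiE //; case: (h _ (SU x Sx)).
pose w i := widen_ord (leqnSn 4) i.
apply: (@no_contraction k hk n (G ja) (G jb) (G jc) (G jd)
  (fun j => msubst (fun i => 'X_(w i)) (F j))).
  (* The determinant identity spreads from the nonempty open [U] to the whole affine space. *)
  apply/eqP; rewrite -subr_eq0; apply/eqP; apply: (ev_eq0_on oU neU) => y Uy.
  by rewrite !evE -!hG // (US y Uy) subrr.
move=> x Sx y; pose x' : 'rV[k]_4 := \row_i x 0 (w i).
have xw (i : 'I_4) (j : 'I_5) : (i : nat) = j -> x 0 j = x' 0 i.
  by move=> e; rewrite mxE; congr (x 0 _); apply: val_inj; rewrite /= e.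
have Sx' : SL2k x' by rewrite /SL2 -!(xw ja va, xw jb vb, xw jc vc, xw jd vd).
have -> : y = phi x'.
  apply/rowP=> j; rewrite mxE ev_msubst hF //; congr ev.
  by apply/rowP=> i; rewrite !mxE evX.
have Ux' := SU _ Sx'.
by rewrite -!hG // psiphi //; split; symmetry; apply: xw.
Qed.

End NotFlattenable.

Theorem theorem17 (k : closedFieldType) (hk : [pchar k] =i pred0) :
  exists (n m : nat) (X : subset_of_space k n) (Y : subset_of_space k m),
    [/\ zariski_closed X /\ irreducible_set X,
        zariski_closed Y /\ irreducible_set Y,
        ~ flattenable X,
        flattenable Y &
        flattenable (product_set X Y)].
Proof.
exists 4, 2, (@SL2 k), (@hyperbola k); split.
- by split; [apply: SL2_closed | apply: SL2_irreducible].
- by split; [apply: hyperbola_closed | case: (hyperbola_flattenable k)].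
- exact: SL2_not_flattenable.
- exact: hyperbola_flattenable.
- exact: product_flattenable.
Qed.
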